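(* Let $d\ge2$, $2\le m\le d$, $\boldsymbol{x},\boldsymbol{y}\in\mathbb{R}^d$ and $z=\|\boldsymbol{x}-\boldsymbol{y}\|_2$. For the random Fourier feature estimator of $\exp(-\|\boldsymbol{x}-\boldsymbol{y}\|_2^2/2)$ with $m$ random vectors, the difference between the mean squared errors using IIDRFs and using ORFs is $$\mathrm{MSE}_{\mathrm{IIDRF}}-\mathrm{MSE}_{\mathrm{ORF}}=\frac{m-1}{m}\left(e^{-z^2}-\frac{\Gamma(d/2)}{\Gamma(d)}\sum_{k=0}^\infty\frac{(-z^2)^k}{2^kk!}\frac{\Gamma(k+d)}{\Gamma(k+d/2)}\right).$$
   Context: Random Fourier features: $\phi(\boldsymbol{z})=\frac{1}{\sqrt m}\big(\sin(\boldsymbol{w}_1^\top\boldsymbol{z}),\cos(\boldsymbol{w}_1^\top\boldsymbol{z}),\dots,\sin(\boldsymbol{w}_m^\top\boldsymbol{z}),\cos(\boldsymbol{w}_m^\top\boldsymbol{z})\big)^\top$, $\widehat K(\boldsymbol{x},\boldsymbol{y})=\phi(\boldsymbol{x})^\top\phi(\boldsymbol{y})=\frac1m\sum_i\cos(\boldsymbol{w}_i^\top(\boldsymbol{x}-\boldsymbol{y}))$, and $\mathrm{MSE}=\mathbb{E}[(\widehat K-\exp(-\|\boldsymbol{x}-\boldsymbol{y}\|_2^2/2))^2]$. IIDRFs: $\boldsymbol{w}_1,\dots,\boldsymbol{w}_m$ i.i.d. $\mathcal{N}(0,\mathbf{I}_d)$. ORFs: $\boldsymbol{w}_i$ ($i\le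 m$) are the first $m$ rows of $\mathrm{diag}(w_1,\dots,w_d)\mathbf{R}$ with $w_i$ i.i.d. $\chi_d$ and $\mathbf{R}$ Haar-distributed on $\mathrm{O}(d)$, independent. *)

(* Defs.v *)
From HB Require Import structures.
From mathcomp Require Import all_boot all_order all_algebra.
From mathcomp Require Import all_classical all_reals all_analysis.
Set Implicit Arguments. Unset Strict Implicit. Unset Printing Implicit Defensive.
Import Order.TTheory GRing.Theory Num.Theory.
Import numFieldNormedType.Exports.
Local Open Scope classical_set_scope.
Local Open Scope ring_scope.

Section Defs.
Context {R : realType}.

Definition Gamma (s : R) : R :=
  fine (\int[@lebesgue_measure R]_(t in `]0%R, +oo[) (powR t (s - 1) * expR (- t))%:E).

Definition chi_unnorm (d : nat) (r : R) : R :=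
  if (0 <= r) then r ^+ d.-1 * expR (- (r ^+ 2) / 2) else 0.
Definition chi_pdf (d : nat) (r : R) : R :=
  chi_unnorm d r / fine (\int[@lebesgue_measure R]_(t in [set: R]) (chi_unnorm d t)%:E).

Definition mutually_independent {dT : measure_display} {T : measurableType dT}
  (P : probability T R) (I : finType) (X : I -> T -> R) : Prop :=
  forall B : I -> set R, (forall i, measurable (B i)) ->
    P (\bigcap_(i in [set: I]) (X i @^-1` B i)) =
    (\big[*%E/1%E]_(i : I) P (X i @^-1` B i))%E.

(** independence of two finite random vectors (families) X and Y
    (product rule on measurable rectangles, which generate the joint laws) *)
Definition independent_vectors {dT : measure_display} {T : measurableType dT}
  (P : probability T R) (I J : finType) (X : I -> T -> R) (Y : J -> T -> R) : Prop :=
  forall (A : I -> set R) (B : J -> set R),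
    (forall i, measurable (A i)) -> (forall j, measurable (B j)) ->
    P (\bigcap_(i in [set: I]) (X i @^-1` A i) `&` \bigcap_(j in [set: J]) (Y j @^-1` B j)) =
    (P (\bigcap_(i in [set: I]) (X i @^-1` A i)) * P (\bigcap_(j in [set: J]) (Y j @^-1` B j)))%E.

Definition orthogonal_mx (n : nat) (U : 'M[R]_n) : bool := U *m U^T == 1%:M.

(** Q is a Haar-distributed random matrix on O(n): almost surely orthogonal,
    and its law is invariant under left multiplication by any fixed
    orthogonal matrix (the normalized Haar measure of the compact group O(n)
    is the unique such probability law). Laws of random matrices are compared
    on measurable rectangles of entries. *)
Definition haar_orthogonal {dT : measure_display} {T : measurableType dT}
  (P : probability T R) (n : nat) (Q : T -> 'M[R]_n) : Prop :=
  {ae P, forall w, orthogonal_mx (Q w)} /\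
  forall U : 'M[R]_n, orthogonal_mx U ->
  forall B : 'I_n -> 'I_n -> set R, (forall j k, measurable (B j k)) ->
    P [set w | forall j k, B j k ((U *m Q w) j k)] =
    P [set w | forall j k, B j k (Q w j k)].

Definition rff_estimator (m d : nat) (W : 'I_m -> 'rV[R]_d) (x y : 'rV[R]_d) : R :=
  m%:R^-1 * \sum_(i < m) cos (\sum_(j < d) W i 0 j * (x 0 j - y 0 j)).

Definition gauss_kernel (d : nat) (x y : 'rV[R]_d) : R :=
  expR (- (\sum_(j < d) (x 0 j - y 0 j) ^+ 2) / 2).

Definition rff_mse {dT : measure_display} {T : measurableType dT}
  (P : probability T R) (m d : nat) (W : T -> 'I_m -> 'rV[R]_d) (x y : 'rV[R]_d) : \bar R :=
  (\int[P]_(w in [set: T]) ((rff_estimator (W w) x y - gauss_kernel x y) ^+ 2)%:E)%E.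

End Defs.

(* Main.v *)
Require Import Defs.
From HB Require Import structures.
From mathcomp Require Import all_boot all_order all_algebra.
From mathcomp Require Import all_classical all_reals all_analysis.
From mathcomp Require Import measurable_realfun ring lra.
Set Implicit Arguments. Unset Strict Implicit. Unset Printing Implicit Defensive.
Import Order.TTheory GRing.Theory Num.Theory.
Import numFieldNormedType.Exports.
Local Open Scope classical_set_scope.
Local Open Scope ring_scope.

(**
Write [v = x - y] and [z = |v|].  Both mean squared errors depend only on the
means of [cos a_i], [cos (2 a_i)] and [cos (a_i +- a_j)], where [a_i] is the
projection of the [i]-th feature on [v].  The first two agree in both models,
so only the mean of [cos (a_i +- a_j)] matters: it is [exp (- z^2)] for
independent Gaussian features.

In the orthogonal model [a_i = s_i u_i] with [u = Q v].  Left invariance of the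
law of [Q] gives [E <p, u>^(2k) = |p|^(2k) e_k] for every fixed vector [p];
reading off the coefficient of [b^2] in [E (u_i + b u_j)^(2k)] and using
[|u| = z] yields [e_(k+1) (2k + d) = z^2 e_k (2k + 1)].  With [p] supported on
[i] and [j], the even moments of [a_i +- a_j] are [e_k E (s_i^2 + s_j^2)^k],
where the chi moments combine by a Vandermonde convolution into those of a
chi variable with [2d] degrees of freedom.  The cosine series can be integrated
termwise because these moments are dominated by those of an exponential series.
*)

(** * Rising factorials with step two *)

(** The Haar hypothesis gives no density for the direction [u], only almost sure orthogonality and
    an invariance tested on rectangles. Even moments are what can be reached from it: one reflection
    and one polynomial identity replace any integral over the sphere. Independence is likewise a
    product rule on rectangles, so it is first turned into iterated integrals over two copies of the
    space. The Gamma quotient has the following origin. The moment [e_k] is [z^(2k)] times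
    1(1+2)...(1+2(k-1)) divided by d(d+2)...(d+2(k-1)). For one feature this denominator is
    cancelled by the chi moment, which leaves Gaussian moments. For a pair, the radii contribute
    2d(2d+2)...(2d+2(k-1)) instead. The quotient of the two products remains, and each is [2^k]
    times a quotient of Gamma values: Gamma(k+d)/Gamma(d) above, Gamma(k+d/2)/Gamma(d/2) below. *)

Section double_rising.
Context {R : realType}.

(** The 2k-th moment of a chi variable with [x] degrees of freedom; at [x = 1] it is the double
    factorial (2k-1)!!, the 2k-th moment of a standard normal variable. *)
Definition double_rising (x : R) k := \prod_(i < k) (x + 2 * i%:R).

Lemma double_risingS x k : double_rising x k.+1 = double_rising x k * (x + 2 * k%:R).
Proof. exact: big_ord_recr. Qed.

Lemma double_rising0 x : double_rising x 0 = 1.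
Proof. exact: big_ord0. Qed.

Lemma double_rising_gt0 x k : 0 < x -> 0 < double_rising x k.
Proof. by move=> x0; apply: prodr_gt0 => i _; rewrite ltr_pwDl// mulr_ge0. Qed.

(** Chu-Vandermonde convolution. Pascal's rule splits the sum for k+1 into two sums in which the old
    term of index l carries the factor x + 2(k-l) or y + 2l; these two factors add up to x + y +
    2k. *)
Lemma double_rising_binomial x y k :
  \sum_(l < k.+1) 'C(k, l)%:R * (double_rising x (k - l) * double_rising y l) =
  double_rising (x + y) k.
Proof.
elim: k => [|k IHk]; first by rewrite big_ord1 bin0 subnn !double_rising0 !mulr1.
rewrite big_ord_recl bin0 subn0 double_rising0 mulr1 mul1r.
under eq_bigr => l _ do rewrite binS subSS natrD mulrDl.
rewrite big_split/= addrA.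
have -> : double_rising x k.+1 + \sum_(l < k.+1) 'C(k, l.+1)%:R *
      (double_rising x (k - l) * double_rising y l.+1) =
    \sum_(l < k.+1) 'C(k, l)%:R * (double_rising x (k - l) * double_rising y l) * (x + 2 * (k - l)%:R).
  rewrite big_ord_recr/= bin_small// mul0r addr0 [RHS]big_ord_recl/=.
  rewrite bin0 subn0 double_rising0 mul1r mulr1 -double_risingS; congr (_ + _).
  apply: eq_bigr => l _; rewrite /bump/= add1n.
  have -> : (k - l)%N = (k - l.+1).+1 by rewrite -subSS subSn.
  by rewrite (double_risingS x); ring.
rewrite -big_split/= double_risingS -IHk big_distrl/=.
apply: eq_bigr => l _; rewrite double_risingS natrB; last by rewrite -ltnS.
by ring.
Qed.

Lemma double_risingE x k : double_rising x k = 2 ^+ k * \prod_(i < k) (x / 2 + i%:R).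
Proof.
elim: k => [|k IHk]; first by rewrite double_rising0 big_ord0 expr0 mulr1.
rewrite double_risingS IHk big_ord_recr/= exprS.
by move: (\prod_(i < k) _) (2 ^+ k) => p q; field.
Qed.

(** Factor by factor, x + x + 2i is at most 2(x + 2i). This bound compares the moment series of a
    pair of orthogonal features with an exponential series. *)
Lemma double_rising_ratio_le x k : 0 < x ->
  double_rising (x + x) k / double_rising x k <= 2 ^+ k.
Proof.
move=> x0; rewrite ler_pdivrMr ?double_rising_gt0//.
elim: k => [|k IHk]; first by rewrite !double_rising0 expr0 mulr1.
rewrite !double_risingS exprS [leRHS](_ : _ =
  2 ^+ k * double_rising x k * (2 * (x + 2 * k%:R))); last by ring.
have k0 : 0 <= 2 * k%:R :> R by rewrite mulr_ge0.
apply: ler_pM => //.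
- by rewrite ltW// double_rising_gt0// addr_gt0.
- by rewrite !addr_ge0// ltW.
- by move: k0; lra.
Qed.

End double_rising.

(** * Laws of finite families and independence *)

Section finite_families.
Context {R : realType} (I : finType).

(* The product sigma-algebra on [I -> R] is generated by the measurable
   rectangles, so the hypotheses on rectangles determine the joint laws. *)
Definition rectangles : set (set (I -> R)) :=
  [set A | exists2 B : I -> set R, (forall i, measurable (B i)) &
    A = [set f | forall i, B i (f i)]].

Definition famType := g_sigma_algebraType rectangles.

Lemma measurable_fam_coord (i : I) :
  measurable_fun [set: famType] (fun f : famType => f i).
Proof.
move=> _ B mB; rewrite setTI; apply: sub_sigma_algebra.
exists (fun j => if j == i then B else setT).
  by move=> j; case: ifP.
apply/seteqP; split => [f Bf j|f /(_ i)] /=; last by rewrite eqxx.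
by case: eqP => [->|].
Qed.

Lemma measurable_fam d (T : measurableType d) (X : I -> T -> R) :
  (forall i, measurable_fun setT (X i)) ->
  measurable_fun [set: T] (fun w => (X ^~ w : famType)).
Proof.
move=> mX; apply: (@measurability _ _ T famType _ _ rectangles) => // _ [_ [B mB ->] <-].
rewrite setTI.
have -> : (fun w => X ^~ w) @^-1` [set f | forall i, B i (f i)]
    = \big[setI/setT]_(i <- enum I) (X i @^-1` B i).
  rewrite -bigcap_seq; apply/seteqP; split => w /= h i; first by move=> _; exact: h.
  by apply: h => /=; rewrite mem_enum.
by apply: bigsetI_measurable => i _; rewrite -[X in measurable X]setTI; exact: mX.
Qed.

Lemma rectangles_setT : rectangles [set: I -> R].
Proof. by exists (fun=> setT) => //; apply/seteqP; split. Qed.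

Lemma rectangles_setI : setI_closed rectangles.
Proof.
move=> _ _ [B mB ->] [C mC ->]; exists (fun i => B i `&` C i).
  by move=> i; exact: measurableI.
apply/seteqP; split => f /=; first by move=> [fB fC] i; split.
by move=> fBC; split=> i; have [] := fBC i.
Qed.

Section same_law.
Context d1 d2 (T1 : measurableType d1) (T2 : measurableType d2).
Variables (P1 : probability T1 R) (P2 : probability T2 R).
Variables (X : I -> T1 -> R) (Y : I -> T2 -> R).
Hypothesis mX : forall i, measurable_fun setT (X i).
Hypothesis mY : forall i, measurable_fun setT (Y i).
Hypothesis XY : forall B : I -> set R, (forall i, measurable (B i)) ->
  P1 [set w | forall i, B i (X i w)] = P2 [set w | forall i, B i (Y i w)].

(** Uniqueness of finite measures on a pi-system: the rectangles are stable under intersection,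
    contain the whole space and generate the sigma-algebra of [famType]. *)
Lemma same_law_pushforward (A : set famType) : measurable A ->
  pushforward P1 (fun w => (X ^~ w : famType)) A =
  pushforward P2 (fun w => (Y ^~ w : famType)) A.
Proof.
have mX' := measurable_fam mX; have mY' := measurable_fam mY.
pose fX := isMeasurableFun.Build _ _ _ _ _ mX'.
pose gX : {mfun T1 >-> famType} := HB.pack (fun w => (X ^~ w : famType)) fX.
pose fY := isMeasurableFun.Build _ _ _ _ _ mY'.
pose gY : {mfun T2 >-> famType} := HB.pack (fun w => (Y ^~ w : famType)) fY.
move=> mA.
apply: (@measure_unique _ R famType rectangles (fun=> setT) _ _ _ _
  (distribution P1 gX) (distribution P2 gY)) => //.
- exact: rectangles_setI.
- by move=> _; exact: rectangles_setT.
- by rewrite bigcup_const.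
- by move=> _ [B mB ->]; exact: XY.
- by move=> _; apply: (le_lt_trans (probability_le1 (distribution P1 gX) measurableT)); rewrite ltry.
Qed.

(** The nonnegative form serves even moments, whose finiteness is not known in advance; the bounded
    form that follows serves cosines. *)
Lemma same_law_ge0_integral (h : famType -> \bar R) :
  measurable_fun [set: famType] h -> (forall f, 0 <= h f)%E ->
  (\int[P1]_w h (X ^~ w) = \int[P2]_w h (Y ^~ w))%E.
Proof.
move=> mh h0.
have mX' := measurable_fam mX; have mY' := measurable_fam mY.
rewrite -(ge0_integral_pushforward mX' P1 measurableT mh)//.
rewrite -(ge0_integral_pushforward mY' P2 measurableT mh)//.
by apply: eq_measure_integral => A mA _; exact: same_law_pushforward.
Qed.

Lemma same_law_integral (h : famType -> R) (M : R) :
  measurable_fun [set: famType] h -> (forall f, `|h f| <= M) ->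
  (\int[P1]_w (h (X ^~ w))%:E = \int[P2]_w (h (Y ^~ w))%:E)%E.
Proof.
move=> mh hM.
have mX' := measurable_fam mX; have mY' := measurable_fam mY.
have bounded_int d (T : measurableType d) (P : probability T R) (g : T -> famType) :
    measurable_fun setT g -> P.-integrable (g @^-1` setT) ((EFin \o h) \o g).
  move=> mg; rewrite preimage_setT.
  apply: (@measurable_bounded_integrable _ _ _ P (h \o g)) => //.
  - by apply: (le_lt_trans (probability_le1 P measurableT)); rewrite ltry.
  - exact: measurableT_comp.
  - by exists M; split => [|x Mx w _]; first exact: num_real; rewrite /= (le_trans (hM _))// ltW.
have mEh : measurable_fun [set: famType] (fun f => (h f)%:E) by exact/measurable_EFinP.
have := integral_pushforward mX' mEh (bounded_int _ _ _ _ mX') measurableT.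
have := integral_pushforward mY' mEh (bounded_int _ _ _ _ mY') measurableT.
rewrite !preimage_setT /= => <- <-.
by apply: eq_measure_integral => A mA _; exact: same_law_pushforward.
Qed.

End same_law.

End finite_families.
Arguments famType R I : clear implicits.

Section splitting.
Context {R : realType} (I : finType) d (T : measurableType d).
Variables (P : probability T R) (X : I -> T -> R).
Hypothesis mX : forall i, measurable_fun setT (X i).

(* Independence of the subfamilies [(X i)_(S i)] and [(X i)_(~~ S i)]. *)
Definition splits (S : pred I) :=
  forall B : I -> set R, (forall i, measurable (B i)) ->
  P [set w | forall i, B i (X i w)] =
  (P [set w | forall i, S i -> B i (X i w)] *
   P [set w | forall i, ~~ S i -> B i (X i w)])%E.

Definition mergefam (S : pred I) (u : T * T) (i : I) : R :=
  if S i then X i u.1 else X i u.2.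

Lemma measurable_mergefam (S : pred I) i :
  measurable_fun setT (fun u => mergefam S u i).
Proof.
rewrite /mergefam; case: (S i).
  exact: (measurableT_comp (mX i) measurable_fst).
exact: (measurableT_comp (mX i) measurable_snd).
Qed.

Lemma measurable_rectangle (D : pred I) (B : I -> set R) :
  (forall i, measurable (B i)) ->
  measurable [set w | forall i, D i -> B i (X i w)].
Proof.
move=> mB.
have -> : [set w | forall i, D i -> B i (X i w)]
    = \big[setI/setT]_(i <- enum D) (X i @^-1` B i).
  rewrite -bigcap_seq; apply/seteqP; split => w /= h i.
    by rewrite /= mem_enum; exact: h.
  by move=> Di; apply: h => /=; rewrite mem_enum.
by apply: bigsetI_measurable => i _; rewrite -[X in measurable X]setTI; exact: mX.
Qed.

(* An independent splitting is realized on two independent copies of [P]. *)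
Lemma splits_same_law (S : pred I) : splits S ->
  forall B : I -> set R, (forall i, measurable (B i)) ->
  P [set w | forall i, B i (X i w)] =
  (P \x P)%E [set u | forall i, B i (mergefam S u i)].
Proof.
move=> sS B mB; rewrite sS//.
rewrite -product_measure1E; [|exact: measurable_rectangle..].
congr ((P \x P)%E _); apply/seteqP; split => [[u v] /= [h1 h2] i|[u v] /= h].
  by rewrite /mergefam; case: ifPn => Si; [exact: h1|exact: h2].
by split => i Si; have := h i; rewrite /mergefam ?Si ?(negbTE Si).
Qed.

Lemma splits_ge0_integral (S : pred I) (h : famType R I -> \bar R) : splits S ->
  measurable_fun setT h -> (forall f, 0 <= h f)%E ->
  (\int[P]_w h (X ^~ w) = \int[P]_u \int[P]_v h (mergefam S (u, v)))%E.
Proof.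
move=> sS mh h0.
rewrite (same_law_ge0_integral mX (measurable_mergefam S) (splits_same_law sS) mh h0).
rewrite (@fubini_tonelli1 _ _ _ _ _ P P (fun u => h (mergefam S u)))//.
exact: (measurableT_comp mh (measurable_fam (measurable_mergefam S))).
Qed.

Lemma splits_integral (S : pred I) (h : famType R I -> R) (M : R) : splits S ->
  measurable_fun setT h -> (forall f, `|h f| <= M) ->
  (\int[P]_w (h (X ^~ w))%:E = \int[P]_u \int[P]_v (h (mergefam S (u, v)))%:E)%E.
Proof.
move=> sS mh hM.
rewrite (same_law_integral mX (measurable_mergefam S) (splits_same_law sS) mh hM).
have mhm : measurable_fun setT (fun u => h (mergefam S u)).
  exact: (measurableT_comp mh (measurable_fam (measurable_mergefam S))).
rewrite -(@integral12_prod_meas1 _ _ _ _ _ P P (fun u => (h (mergefam S u))%:E))//.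
apply: (@measurable_bounded_integrable _ _ _ (P \x P)%E) => //.
  by apply: (le_lt_trans (probability_le1 (P \x P)%E measurableT)); rewrite ltry.
by exists M; split => [|x Mx u _]; first exact: num_real; rewrite /= (le_trans (hM _))// ltW.
Qed.

(** Replacing [B i] by the whole line outside a subset [D] gives the product rule for the subfamily
    on [D]. Both sides then are the same product over [I], cut along [S]. *)
Lemma mutually_independent_splits (S : pred I) :
  mutually_independent P X -> splits S.
Proof.
move=> iX B mB.
have rectE (D : pred I) : P [set w | forall i, D i -> B i (X i w)] =
    (\prod_(i | D i) P (X i @^-1` B i))%E.
  have := iX (fun i => if D i then B i else setT).
  have -> : \bigcap_(i in [set: I]) (X i @^-1` (if D i then B i else setT)) =
      [set w | forall i, D i -> B i (X i w)].
    apply/seteqP; split => w /= h i; first by move=> Di; have := h i Logic.I; rewrite Di.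
    by move=> _; case: ifPn => // Di; exact: h.
  move=> ->; last by move=> i; case: ifP.
  rewrite [RHS]big_mkcond/=; apply: eq_bigr => i _; case: ifP => // _.
  by rewrite preimage_setT probability_setT.
rewrite (_ : [set w | _] = [set w | forall i, xpredT i -> B i (X i w)]).
  by rewrite !rectE (bigID S).
by apply/seteqP; split => w /= h i //; exact: h.
Qed.

End splitting.

(** * Cosine means from even moments *)

Section cosine_series.
Context {R : realType} d (T : measurableType d) (P : probability T R).

(** Dominated convergence: the partial sums of the cosine series are bounded by the series [g] of
    cosh (X w), whose mean is the sum of [M k / k.*2], taken with a factorial below, and this sum is
    finite by the convergence hypothesis. *)
Lemma integral_cos_even_moments (X : T -> R) (M : nat -> R) :
  measurable_fun setT X ->
  (forall k, (\int[P]_w (X w ^+ k.*2)%:E = (M k)%:E)%E) ->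
  cvgn (series (fun k => M k / k.*2`!%:R)) ->
  (\int[P]_w (cos (X w))%:E =
    (limn (series (fun k => (-1) ^+ k * M k / k.*2`!%:R)))%:E)%E.
Proof.
move=> mX EX cM.
have even_ge0 (x : R) k : 0 <= x ^+ k.*2 by rewrite exprn_even_ge0 ?odd_double.
have M_ge0 k : 0 <= M k.
  by rewrite -lee_fin -EX integral_ge0// => w _; rewrite lee_fin.
have mXk k : measurable_fun setT (fun w => (X w ^+ k.*2)%:E).
  by apply/measurable_EFinP/measurable_funX.
have term_ge0 k w : (0 <= (X w ^+ k.*2 / k.*2`!%:R)%:E)%E.
  by rewrite lee_fin divr_ge0.
have mterm k : measurable_fun setT (fun w => (X w ^+ k.*2 / k.*2`!%:R)%:E).
  by apply/measurable_EFinP/measurable_funM => //; exact/measurable_funX.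
have int_term k : (\int[P]_w (X w ^+ k.*2 / k.*2`!%:R)%:E = (M k / k.*2`!%:R)%:E)%E.
  under eq_integral do rewrite EFinM.
  by rewrite ge0_integralZr ?EX//= => *; rewrite ?lee_fin ?invr_ge0.
pose g w := (\sum_(0 <= k <oo) (X w ^+ k.*2 / k.*2`!%:R)%:E)%E.
have mg : measurable_fun setT g by exact: ge0_emeasurable_sum.
have g_int : P.-integrable setT g.
  apply/integrableP; split => //.
  under eq_integral do rewrite gee0_abs ?nneseries_ge0//.
  rewrite integral_nneseries//.
  under eq_eseriesr do rewrite int_term.
  rewrite (_ : limn _ = (limn (series (fun k => M k / k.*2`!%:R)))%:E) ?ltry//.
  by rewrite -EFin_lim//; congr (limn _); apply/funext => n; rewrite /= sumEFin.
pose f n w := (series (cos_coeff' (X w)) n)%:E.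
have fE n w : f n w = (\sum_(0 <= k < n) (((-1) ^+ k * (X w ^+ k.*2)) / k.*2`!%:R)%:E)%E.
  by rewrite sumEFin.
have mcoef k : measurable_fun setT (fun w => (((-1) ^+ k * (X w ^+ k.*2)) / k.*2`!%:R)).
  by apply: measurable_funM => //; apply: measurable_funM => //; exact/measurable_funX.
have mf n : measurable_fun setT (f n).
  rewrite (_ : f n = fun w => (\sum_(0 <= k < n) (((-1) ^+ k * (X w ^+ k.*2)) / k.*2`!%:R)%:E)%E).
    by apply: emeasurable_sum => k; apply/measurable_EFinP.
  by apply/funext => w; rewrite fE.
have mcos : measurable_fun setT (fun w => (cos (X w))%:E).
  apply/measurable_EFinP/measurableT_comp => //.
  by apply: continuous_measurable_fun; exact: continuous_cos.
have int_coef k : P.-integrable setT (fun w => (((-1) ^+ k * (X w ^+ k.*2)) / k.*2`!%:R)%:E).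
  apply/integrableP; split; first exact/measurable_EFinP.
  rewrite (eq_integral (fun w => (X w ^+ k.*2 / k.*2`!%:R)%:E)) ?int_term ?ltry//.
  move=> w _; rewrite abse_EFin; congr EFin.
  by rewrite !normrM normfV normr_nat normrX normrN1 expr1n mul1r ger0_norm.
have f_cvg w : f ^~ w @ \oo --> (cos (X w))%:E.
  by apply: cvg_EFin; [exact: nearW|exact: cvg_cos_coeff'].
have f_le w n : (`|f n w| <= g w)%E.
  rewrite fE (le_trans (lee_abs_sum _ _ _))//.
  rewrite (le_trans _ (nneseries_lim_ge n _))//.
  apply: lee_sum => k _; rewrite abse_EFin lee_fin.
  by rewrite !normrM normfV normr_nat normrX normrN1 expr1n mul1r ger0_norm.
have [_ _] := dominated_convergence measurableT mf mcos
  (aeW P (fun w _ => f_cvg w)) g_int (aeW P (fun w n _ => f_le w n)).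
move=> /cvg_lim <-//.
rewrite (_ : (fun n => _) = EFin \o series (fun k => (-1) ^+ k * M k / k.*2`!%:R)).
  rewrite EFin_lim//.
  suff : cvgn (series (fun k => `|(-1) ^+ k * M k / k.*2`!%:R|)) by move=> /normed_cvg.
  rewrite (_ : (fun k => `|_|) = fun k => M k / k.*2`!%:R)//; apply/funext => k.
  by rewrite !normrM normfV normr_nat normrX normrN1 expr1n mul1r ger0_norm.
apply/funext => n /=.
under eq_integral do rewrite fE.
rewrite integral_sum//= -sumEFin; apply: eq_bigr => k _.
under eq_integral do rewrite -mulrA EFinM.
rewrite integralZl//=; first by rewrite int_term -EFinM mulrA.
apply/integrableP; split=> //.
by under eq_integral do rewrite gee0_abs//; rewrite int_term ltry.
Qed.

(** Separates the even factors of (2k)! from the odd ones. *)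
Lemma fact_double k : (k.*2)`!%:R = 2 ^+ k * k`!%:R * double_rising 1 k :> R.
Proof.
elim: k => [|k IHk]; first by rewrite double_rising0 fact0 expr0 !mul1r.
rewrite doubleS !factS !natrM mulrA IHk double_risingS exprS.
by rewrite -!natr1 -muln2 natrM; ring.
Qed.

(** The odd factors of (2k)! cancel the moment, and the exponential series at - t / 2 remains. A
    single orthogonal feature is treated by this lemma as well as a normal variable. *)
Lemma integral_cos_gauss_moments (X : T -> R) (t : R) :
  measurable_fun setT X ->
  (forall k, (\int[P]_w (X w ^+ k.*2)%:E = (t ^+ k * double_rising 1 k)%:E)%E) ->
  (\int[P]_w (cos (X w))%:E = (expR (- t / 2))%:E)%E.
Proof.
move=> mX EX.
(* Used with c = 1 for the convergence of the dominating series and with c = -1 for the value. *)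
have coefE c k : c ^+ k * (t ^+ k * double_rising 1 k) / k.*2`!%:R =
    exp_coeff (c * t / 2) k.
  rewrite fact_double /exp_coeff/= !exprMn exprVn.
  have := @double_rising_gt0 R 1 k ltr01; move: (double_rising 1 k) => p p0.
  have k0 : 0 < k`!%:R :> R by rewrite ltr0n fact_gt0.
  have q0 : 0 < 2 ^+ k :> R by exact: exprn_gt0.
  move: (k`!%:R) k0 (2 ^+ k) q0 (c ^+ k) (t ^+ k) => f f0 q q0 a b.
  by field; rewrite !gt_eqF.
have M_cvg : cvgn (series (fun k => t ^+ k * double_rising 1 k / k.*2`!%:R)).
  rewrite (_ : (fun k => _) = exp_coeff (1 * t / 2)).
    exact: is_cvg_series_exp_coeff.
  by apply/funext => k; rewrite -coefE expr1n mul1r.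
rewrite (integral_cos_even_moments mX EX M_cvg).
congr EFin; rewrite /expR; congr (limn (series _)); apply/funext => k.
by rewrite coefE mulN1r.
Qed.

End cosine_series.

(** * Integration by parts on the half line, Gamma function *)

Section half_line.
Context {R : realType}.
Notation mu := (@lebesgue_measure R).

(** [F] is the boundary term, vanishing at 0 and at infinity. Both integrals may be infinite a
    priori: on [0, n+1] all is finite, and nonnegativity allows the passage to the limit by monotone
    convergence. The bound [C / x] compares [F] with the harmonic sequence. *)
Lemma ge0_integral_y_by_parts (F g1 g2 : R -> R) (C : R) :
  (forall x, 0 <= x -> 0 <= g1 x) -> (forall x, 0 <= x -> 0 <= g2 x) ->
  {within `[0, +oo[, continuous g1} -> {within `[0, +oo[, continuous g2} ->
  F 0 = 0 -> F x @[x --> 0^'+] --> (0 : R) ->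
  (forall x : R, 0 < x -> is_derive x 1 F (g1 x - g2 x)) ->
  (forall x, 1 <= x -> `|F x| <= C / x) ->
  (\int[mu]_(x in `[0%R, +oo[) (g1 x)%:E = \int[mu]_(x in `[0%R, +oo[) (g2 x)%:E)%E.
Proof.
move=> g1_ge0 g2_ge0 cg1 cg2 F0 Fr dF FC.
have cont_itv (g : R -> R) b : {within `[0, +oo[, continuous g} ->
    {within `[0, b], continuous g}.
  by apply: continuous_subspaceW; exact: subset_itvl.
have int_itv (g : R -> R) b : {within `[0, +oo[, continuous g} ->
    mu.-integrable `[0, b] (EFin \o g).
  by move=> cg; apply: continuous_compact_integrable; [exact: segment_compact|exact: cont_itv].
have cFat x : 0 < x -> {for x, continuous F}.
  move=> x0; apply: differentiable_continuous; apply/derivable1_diffP.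
  by case: (dF x x0).
have FTC n : (\int[mu]_(x in `[0%R, n.+1%:R]) (g1 x)%:E =
    (F n.+1%:R)%:E + \int[mu]_(x in `[0%R, n.+1%:R]) (g2 x)%:E)%E.
  transitivity (\int[mu]_(x in `[0%R, n.+1%:R]) ((g1 x - g2 x)%:E + (g2 x)%:E))%E.
    by apply: eq_integral => x _; rewrite -EFinD subrK.
  have cB : {within `[0, +oo[, continuous (fun x => g1 x - g2 x)}.
    by move=> x; apply: cvgB; [exact: cg1|exact: cg2].
  rewrite integralD//=; [|exact: (int_itv (fun x => g1 x - g2 x))|exact: int_itv].
  congr (_ + _)%E.
  rewrite (@continuous_FTC2 _ (fun x => g1 x - g2 x) F)//.
  - by rewrite F0 sube0.
  - exact: cont_itv.
  - split.
    + by move=> x; rewrite in_itv/= => /andP[x0 _]; case: (dF x x0).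
    + by rewrite F0.
    + by apply: cvg_at_left_filter; exact: cFat.
  - move=> x; rewrite in_itv/= => /andP[x0 _].
    by rewrite derive1E; have := dF x x0; move=> ?; rewrite derive_val.
have cup : \bigcup_n `[0, n.+1%:R]%classic = `[0, +oo[%classic :> set R.
  apply/seteqP; split => x /=; first by move=> [n _] /=; rewrite !in_itv/= andbT => /andP[].
  rewrite in_itv/= andbT => x0; exists (Num.truncn x) => //=.
  by rewrite in_itv/= x0 ltW// truncnS_gt.
have mg (g : R -> R) n : {within `[0, +oo[, continuous g} ->
    measurable_fun (`[0, n.+1%:R]%classic : set R) (fun x => (g x)%:E).
  by move=> cg; apply: (measurable_int mu); exact: int_itv.
have cvg_int (g : R -> R) : (forall x, 0 <= x -> 0 <= g x) ->
    {within `[0, +oo[, continuous g} ->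
    (\int[mu]_(x in `[0%R, n.+1%:R]) (g x)%:E @[n --> \oo] -->
     \int[mu]_(x in `[0%R, +oo[) (g x)%:E)%E.
  move=> g0 cg; rewrite -cup; apply: (@ge0_nondecreasing_set_cvg_integral _ (measurableTypeR R) R (fun n => `[0, n.+1%:R]%classic : set R) (fun x => (g x)%:E) (@lebesgue_measure R : {measure set _ -> \bar R})) => //.
  - move=> n m nm; rewrite subsetEset; apply: subset_itvl.
    by rewrite bnd_simp ler_nat.
  - by move=> i; exact: mg.
  - by move=> i x /=; rewrite in_itv/= => /andP[x0 _]; rewrite lee_fin g0.
have F_cvg : F n.+1%:R @[n --> \oo] --> (0 : R).
  apply: (squeeze_cvgr (f := fun n => - (C * harmonic n)) (h := fun n => C * harmonic n)).
  - apply: nearW => n; rewrite -ler_norml (le_trans (FC _ _))//.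
    by rewrite ler1n.
  - rewrite -oppr0 -(mulr0 C); apply: cvgN; apply: cvgMr; exact: cvg_harmonic.
  - rewrite -[X in _ --> X](mulr0 C); apply: cvgMr; exact: cvg_harmonic.
have lim2 : ((F n.+1%:R)%:E + \int[mu]_(x in `[0%R, n.+1%:R]) (g2 x)%:E)%E @[n --> \oo]
    --> (0%:E + \int[mu]_(x in `[0%R, +oo[) (g2 x)%:E)%E.
  apply: cvgeD; [by []| |exact: cvg_int].
  by apply: cvg_EFin => //; exact: nearW.
rewrite (_ : (fun n => _) = fun n => (\int[mu]_(x in `[0%R, n.+1%:R]) (g1 x)%:E)%E) in lim2.
  by rewrite -[RHS]add0e; exact: (cvg_unique _ (cvg_int g1 g1_ge0 cg1) lim2).
by apply/funext => n; rewrite FTC.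
Qed.

End half_line.

(** * Gaussian integrals over the half line *)

Section half_line_moments.
Context {R : realType}.
Notation mu := (@lebesgue_measure R).

(** Turns exponential decay into the bound [C / x] required for integration by parts. *)
Lemma exprn_le_fact_expR (x : R) n : 0 <= x -> x ^+ n <= n`!%:R * expR x.
Proof.
case: n => [|n] x0; first by rewrite expr0 fact0 mul1r -expR0 ler_expR.
rewrite mulrC -ler_pdivrMr ?ltr0n ?fact_gt0//.
by rewrite (le_trans _ (expR_ge1Dxn n x0))// lerDr.
Qed.

(** Left unnormalized and over the half line, so that it serves both the chi density and, by
    symmetry, the even normal moments. *)
Definition gauss_moment n : \bar R :=
  (\int[mu]_(r in `[0%R, +oo[) (r ^+ n * expR (- r ^+ 2 / 2))%:E)%E.

Lemma continuous_monomial_gauss n : continuous (fun r : R => r ^+ n * expR (- r ^+ 2 / 2)).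
Proof.
move=> x; apply: cvgM; first exact: exprn_continuous.
apply: (@continuous_comp _ _ _ (fun r : R => - r ^+ 2 / 2) expR); last exact: continuous_expR.
apply: cvgM; last exact: cvg_cst.
by apply: cvgN; exact: exprn_continuous.
Qed.

Lemma gauss_momentSS n : gauss_moment n.+2 = ((n.+1)%:R%:E * gauss_moment n)%E.
Proof.
have gauss_ge0 k (x : R) : 0 <= x -> 0 <= x ^+ k * expR (- x ^+ 2 / 2).
  by move=> x0; rewrite mulr_ge0 ?expR_ge0 ?exprn_ge0.
rewrite /gauss_moment -ge0_integralZl_EFin//=; last 2 first.
- move=> x; rewrite /= in_itv/= andbT => x0.
  by rewrite lee_fin gauss_ge0.
- by apply/measurable_EFinP/measurable_funTS; apply: continuous_measurable_fun; exact: continuous_monomial_gauss.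
apply/esym; under eq_integral do rewrite -EFinM.
(* The constant comes from x^(n+2) <= x^(2(n+2)) = 2^(n+2) (x^2/2)^(n+2) for x >= 1, where the last
   power is at most (n+2)! exp (x^2/2). *)
apply: (@ge0_integral_y_by_parts _ (fun r => r ^+ n.+1 * expR (- r ^+ 2 / 2))
  (fun r => n.+1%:R * (r ^+ n * expR (- r ^+ 2 / 2)))
  (fun r => r ^+ n.+2 * expR (- r ^+ 2 / 2)) (2 ^+ n.+2 * n.+2`!%:R)).
- by move=> x x0; rewrite mulr_ge0 ?gauss_ge0.
- by move=> x x0; rewrite gauss_ge0.
- apply: continuous_subspaceT => x; apply: cvgM; first exact: cvg_cst.
  exact: continuous_monomial_gauss.
- by apply: continuous_subspaceT; exact: continuous_monomial_gauss.
- by rewrite expr0n mul0r.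
- rewrite [X in _ --> X](_ : 0 = 0 ^+ n.+1 * expR (- 0 ^+ 2 / 2)); last by rewrite expr0n mul0r.
  by apply: cvg_at_right_filter; exact: continuous_monomial_gauss.
- move=> x x0.
  have dX k : is_derive x 1 (fun r : R => r ^+ k) (k%:R * x ^+ k.-1).
    have := @is_deriveX R _ id k x 1 1 _.
    by rewrite exprfctE /GRing.scale/= mulr1; apply; exact: is_derive_id.
  have dq : is_derive x 1 (fun r : R => - r ^+ 2 / 2) (- x).
    have := @is_deriveZ _ _ _ _ (- 2^-1) x 1 _ (dX 2).
    rewrite (_ : _ *: _ = - x); last by rewrite -[2.-1]/1%N expr1 /GRing.scale/= mulrA mulNr mulVf// mulN1r.
    rewrite (_ : _ \*: _ = fun r : R => - r ^+ 2 / 2)//.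
    by apply/funext => r; rewrite mulNr mulrC -mulNr.
  have := is_deriveM (dX n.+1) (is_derive1_comp (is_derive_expR _) dq).
  rewrite (_ : _ + _ = n.+1%:R * (x ^+ n * expR (- x ^+ 2 / 2)) - x ^+ n.+2 * expR (- x ^+ 2 / 2))//.
  by rewrite /GRing.scale/= (exprSr x n.+1) exprSr; ring.
- move=> x x1; have x0 : 0 < x by exact: lt_le_trans x1.
  rewrite ger0_norm ?mulr_ge0 ?expR_ge0 ?exprn_ge0 ?(ltW x0)//.
  rewrite ler_pdivlMr// mulNr expRN mulrAC -exprSr ler_pdivrMr ?expR_gt0//.
  have x2 : 0 <= x ^+ 2 / 2 by rewrite divr_ge0// sqr_ge0.
  rewrite -mulrA.
  apply: le_trans (ler_wpM2l _ (exprn_le_fact_expR n.+2 x2)); last by rewrite exprn_ge0.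
  rewrite -exprMn mulrC divfK// -exprM mul2n -addnn exprD.
  by rewrite ler_peMl ?exprn_ge0 ?(ltW x0)// exprn_ege1.
Qed.

End half_line_moments.

(** * The Gamma function at arguments at least 1 *)

Section gamma_function.
Context {R : realType}.
Notation mu := (@lebesgue_measure R).

Lemma continuous_within_powR (p : R) : 0 <= p ->
  {within `[0, +oo[, continuous (fun t : R => t `^ p)}.
Proof.
rewrite le_eqVlt => /predU1P[<-|p0].
  rewrite (_ : (fun t : R => _) = cst 1); first by apply: continuous_subspaceT => x; exact: cvg_cst.
  by apply/funext => t; rewrite powRr0.
apply/continuous_within_itvcyP; split; last by rewrite powR0 ?gt_eqF//; exact: powR_cvg0.
move=> x x0; apply: differentiable_continuous; apply/derivable1_diffP.
exact: derivable_powR.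
Qed.

Lemma continuous_within_powR_expRN (p : R) : 0 <= p ->
  {within `[0, +oo[, continuous (fun t : R => t `^ p * expR (- t))}.
Proof.
move=> p0 x; apply: cvgM; first exact: continuous_within_powR.
apply: (@continuous_subspaceT R R _ (fun t => expR (- t))) => y.
apply: (@continuous_comp _ _ _ -%R expR); last exact: continuous_expR.
exact: opp_continuous.
Qed.

(** Extended-valued, so that the recursion holds before finiteness is known, and on the closed half
    line, as integration by parts requires. *)
Definition gamma_integral (s : R) : \bar R :=
  (\int[mu]_(t in `[0%R, +oo[) (t `^ (s - 1) * expR (- t))%:E)%E.

Lemma measurable_powR_expRN (p : R) (D : set R) :
  measurable_fun D (fun t : R => (t `^ p * expR (- t))%:E).
Proof.
apply/measurable_EFinP/measurable_funTS/measurable_funM.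
  exact: measurable_powR.
exact: measurableT_comp.
Qed.

Lemma GammaE (s : R) : Gamma s = fine (gamma_integral s).
Proof.
rewrite /Gamma integral_itv_obnd_cbnd//.
exact: measurable_powR_expRN.
Qed.

(** For x >= 1 the real exponent [s] may be raised to the natural number [(Num.truncn s).+1]; the
    denominator of the bound adds one more power of x. *)
Lemma powR_expRN_bound (s x : R) : 0 <= s -> 1 <= x ->
  x `^ s * expR (- x) <= ((Num.truncn s).+2)`!%:R / x.
Proof.
move=> s0 x1; have x0 : 0 < x by exact: lt_le_trans x1.
rewrite ler_pdivlMr// expRN mulrAC ler_pdivrMr ?expR_gt0//.
apply: le_trans (exprn_le_fact_expR _ (ltW x0)).
rewrite exprSr ler_pM2r// -powR_mulrn ?(ltW x0)// ler_powR// ltW//.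
exact: truncnS_gt.
Qed.

(** The hypothesis keeps the integrand of [gamma_integral s] continuous at 0. The arguments needed
    later, d and d/2 with d >= 2 and their integer shifts, satisfy it. *)
Lemma gamma_integralS (s : R) : 1 <= s ->
  gamma_integral (s + 1) = (s%:E * gamma_integral s)%E.
Proof.
move=> s1; have s0 : 0 < s by exact: lt_le_trans s1.
have pos p (x : R) : 0 <= x `^ p * expR (- x) by rewrite mulr_ge0 ?expR_ge0 ?powR_ge0.
rewrite /gamma_integral addrK -ge0_integralZl_EFin//=; last 3 first.
- by move=> x _; rewrite lee_fin pos.
- exact: measurable_powR_expRN.
- exact: ltW.
apply/esym; under eq_integral do rewrite -EFinM.
apply: (@ge0_integral_y_by_parts _ (fun t => t `^ s * expR (- t))
  (fun t => s * (t `^ (s - 1) * expR (- t)))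
  (fun t => t `^ s * expR (- t)) ((Num.truncn s).+2)`!%:R).
- by move=> x x0; rewrite mulr_ge0 ?pos// ltW.
- by move=> x x0; rewrite pos.
- move=> x; apply: cvgM; first exact: cvg_cst.
  by apply: continuous_within_powR_expRN; rewrite subr_ge0.
- exact/continuous_within_powR_expRN/ltW.
- by rewrite powR0 ?gt_eqF// mul0r.
- have /continuous_within_itvcyP[_] := continuous_within_powR_expRN (ltW s0).
  by rewrite powR0 ?gt_eqF// mul0r.
- move=> x x0; have := is_derive1_powR s x0 => dp.
  apply: is_derive_eq.
  by rewrite /GRing.scale/= mulrN1 mulrN [expR _ * _]mulrC mulrA addrC.
- by move=> x x1; rewrite ger0_norm ?pos//; apply: powR_expRN_bound => //; exact: ltW.
Qed.

Lemma gamma_integral1 : gamma_integral 1 = 1%E.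
Proof.
rewrite /gamma_integral subrr.
under eq_integral do rewrite powRr0 mul1r.
rewrite (@ge0_continuous_FTC2y _ (fun x : R => expR (- x)) (fun x => - expR (- x)) 0 0)//.
- by rewrite oppr0 expR0 sub0e -EFinN opprK.
- apply: continuous_subspaceT => x.
  apply: (@continuous_comp _ _ _ -%R expR); last exact: continuous_expR.
  exact: opp_continuous.
- by rewrite -oppr0; apply: cvgN; exact: cvgr_expR.
- apply: cvg_at_right_filter; apply: cvgN.
  apply: (@continuous_comp _ _ _ -%R expR); last exact: continuous_expR.
  exact: opp_continuous.
- move=> x _; rewrite derive1E derive_val /GRing.scale/=.
  by rewrite mulrN1 opprK.
Qed.

Lemma gamma_integral_nat n : gamma_integral n.+1%:R = (n`!%:R)%:E.
Proof.
elim: n => [|n IHn]; first by rewrite gamma_integral1.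
by rewrite -natr1 gamma_integralS ?ler1n// IHn -EFinM factS natrM.
Qed.

(** With a natural number n >= s, the power t^(s-1) is at most 1 + t^n, and the integrals of exp (-
    t) and t^n exp (- t) are known factorials. *)
Lemma gamma_integral_fin_num (s : R) : 1 <= s -> gamma_integral s \is a fin_num.
Proof.
move=> s1; have s0 : 0 <= s by exact: le_trans s1.
have pos p (x : R) : 0 <= x `^ p * expR (- x) by rewrite mulr_ge0 ?expR_ge0 ?powR_ge0.
rewrite ge0_fin_numE; last by apply: integral_ge0 => x _; rewrite lee_fin pos.
pose n := (Num.truncn s).+1.
have sn : s <= n%:R by exact/ltW/truncnS_gt.
apply: (@le_lt_trans _ _ (gamma_integral 1 + gamma_integral n.+1%:R)%E); last first.
  by rewrite gamma_integral1 gamma_integral_nat ltry.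
rewrite /gamma_integral -ge0_integralD//=; first last.
- exact: measurable_powR_expRN.
- by move=> x _; rewrite lee_fin pos.
- exact: measurable_powR_expRN.
- by move=> x _; rewrite lee_fin pos.
apply: ge0_le_integral => //=.
- by move=> x _; rewrite lee_fin pos.
- exact: measurable_powR_expRN.
- by apply: emeasurable_funD; exact: measurable_powR_expRN.
move=> x; rewrite in_itv/= andbT => x0.
rewrite -EFinD lee_fin -mulrDl ler_wpM2r ?expR_ge0//.
rewrite subrr powRr0 -natr1 addrK.
have [x1|/ltW x1] := leP x 1; last first.
  by rewrite (@le_trans _ _ (x `^ n%:R))// ?lerDr// ler_powR// lerBlDr (le_trans sn)// lerDl.
rewrite (@le_trans _ _ 1)// ?lerDl ?powR_ge0//.
move: x0; rewrite le_eqVlt => /predU1P[<-|x0].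
  by have [->|s10] := eqVneq (s - 1) 0; [rewrite powRr0|rewrite powR0].
by rewrite -[leRHS](powRr0 x); apply: ger_powR; rewrite ?x0 ?subr_ge0.
Qed.

(** On [1, 2] the integrand is at least exp (- 2). Positivity is needed because Gamma values occur
    as denominators. *)
Lemma gamma_integral_gt0 (s : R) : 1 <= s -> (0 < gamma_integral s)%E.
Proof.
move=> s1.
have pos p (x : R) : 0 <= x `^ p * expR (- x) by rewrite mulr_ge0 ?expR_ge0 ?powR_ge0.
apply: (@lt_le_trans _ _ (\int[mu]_(x in `[1%R, 2%R]) (expR (- 2))%:E)%E).
  rewrite integral_cst//= lebesgue_measure_itv/= lte_fin ltr1n -EFinB.
  by rewrite mule_gt0// lte_fin ?expR_gt0// subr_gt0 ltr1n.
apply: (@le_trans _ (\bar R) (\int[mu]_(t in `[1%R, 2%R]) (t `^ (s - 1) * expR (- t))%:E)%E).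
  apply: ge0_le_integral => //=.
  - exact: measurable_powR_expRN.
  move=> x; rewrite in_itv/= => /andP[x1 x2]; rewrite lee_fin.
  rewrite -[leLHS]mul1r ler_pM ?expR_ge0 ?ler_expR ?lerN2//.
  by rewrite -[leLHS](powRr0 x) ler_powR// subr_ge0.
apply: ge0_subset_integral => //=.
- exact: measurable_powR_expRN.
- by move=> x _; rewrite lee_fin pos.
- move=> x /=; rewrite !in_itv/= andbT => /andP[x1 _].
  exact: le_trans x1.
Qed.

Lemma Gamma_gt0 (s : R) : 1 <= s -> 0 < Gamma s.
Proof.
move=> s1; rewrite GammaE fine_gt0// gamma_integral_gt0//=.
by rewrite -ge0_fin_numE ?gamma_integral_fin_num// ltW// gamma_integral_gt0.
Qed.

Lemma Gamma_natD (s : R) k : 1 <= s ->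
  Gamma (k%:R + s) = (\prod_(i < k) (s + i%:R)) * Gamma s.
Proof.
move=> s1; elim: k => [|k IHk]; first by rewrite add0r big_ord0 mul1r.
have sk : 1 <= k%:R + s by rewrite (le_trans s1)// lerDr.
rewrite -natr1 addrAC GammaE gamma_integralS// fineM ?gamma_integral_fin_num//=.
by rewrite -GammaE IHk big_ord_recr/= mulrA [k%:R + s]addrC [_ * (s + _)]mulrC.
Qed.

End gamma_function.

(** * Chi and normal moments *)

Section density.
Context {R : realType} d (T : measurableType d) (P : probability T R).
Notation mu := (@lebesgue_measure R).
Variables (X : {RV P >-> R}) (p : R -> R).
Hypothesis p_ge0 : forall x, 0 <= p x.
Hypothesis mp : measurable_fun setT p.
Hypothesis lawX : forall B, measurable B ->
  P (X @^-1` B) = (\int[mu]_(x in B) (p x)%:E)%E.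

(** The law of [X] is dominated by the Lebesgue measure. Its Radon-Nikodym derivative has the same
    integral as [p] over every measurable set, hence equals [p] almost everywhere. *)
Lemma ge0_integral_density (f : R -> R) :
  measurable_fun setT f -> (forall x, 0 <= f x) ->
  (\int[P]_w (f (X w))%:E = \int[mu]_x ((f x)%:E * (p x)%:E))%E.
Proof.
move=> mf f_ge0.
have mEf : measurable_fun setT (EFin \o f) by exact/measurable_EFinP.
have mEp : measurable_fun setT (EFin \o p) by exact/measurable_EFinP.
have mX : measurable_fun setT (X : T -> measurableTypeR R).
  by move=> mT A mA; exact: (measurable_funP X mT A mA).
pose X'_mixin := isMeasurableFun.Build _ _ _ _ _ mX.
pose X' : {mfun T >-> measurableTypeR R} := HB.pack (X : T -> measurableTypeR R) X'_mixin.
pose nu : {finite_measure set (measurableTypeR R) -> \bar R} := distribution P X'.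
have dom : nu `<< mu.
  apply/null_content_dominatesP => A mA muA0 /=.
  change (P (X @^-1` A) = 0%E); rewrite lawX//; apply: null_set_integral => //.
  exact: measurable_funTS.
have intp : mu.-integrable setT (EFin \o p).
  apply/integrableP; split => //.
  under eq_integral do rewrite /= ger0_norm//.
  by rewrite -lawX// (le_lt_trans (probability_le1 P _))// ?ltry// preimage_setT.
transitivity (\int[nu]_x (f x)%:E)%E.
  by rewrite (@ge0_integral_distribution _ _ _ _ _ P X' (EFin \o f)).
rewrite -(Radon_Nikodym_SigmaFinite.change_of_variables dom)//.
have RN_int := Radon_Nikodym_SigmaFinite.f_integrable dom.
have mRN := measurable_int _ RN_int.
apply: ge0_ae_eq_integral => //.
- exact: emeasurable_funM.
- exact: emeasurable_funM.
- by move=> x _; rewrite mule_ge0// ?lee_fin// Radon_Nikodym_SigmaFinite.f_ge0.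
- by move=> x _; rewrite mule_ge0// lee_fin.
apply: ae_eqe_mul2l; apply: integral_ae_eq => // E _ mE.
rewrite -(Radon_Nikodym_SigmaFinite.f_integral dom)//.
exact: lawX.
Qed.

End density.

Section chi_and_normal_moments.
Context {R : realType} d (T : measurableType d) (P : probability T R).
Notation mu := (@lebesgue_measure R).
Variable X : {RV P >-> R}.

Lemma gauss_moment_double n k : gauss_moment (n + k.*2) =
  ((double_rising n.+1%:R k)%:E * @gauss_moment R n)%E.
Proof.
elim: k => [|k IHk]; first by rewrite double_rising0 mul1e addn0.
rewrite doubleS !addnS gauss_momentSS IHk muleA -EFinM double_risingS mulrC.
by rewrite -addSn natrD -mul2n natrM.
Qed.

Let even_ge0 k (x : R) : 0 <= x ^+ k.*2.
Proof. by rewrite exprn_even_ge0 ?odd_double. Qed.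

Lemma chi_unnorm_ge0 n (x : R) : 0 <= chi_unnorm n x.
Proof.
by rewrite /chi_unnorm; case: ifPn => // x0; rewrite mulr_ge0 ?expR_ge0 ?exprn_ge0.
Qed.

Lemma chi_unnormE n (x : R) : chi_unnorm n x =
  ((fun r => r ^+ n.-1 * expR (- (r ^+ 2) / 2)) \_ `[0%R, +oo[) x.
Proof.
by rewrite /chi_unnorm patchE mem_setE in_itv/= andbT.
Qed.

Lemma measurable_chi_unnorm n : measurable_fun setT (@chi_unnorm R n).
Proof.
rewrite (_ : chi_unnorm n = (fun r => r ^+ n.-1 * expR (- (r ^+ 2) / 2)) \_ `[0%R, +oo[).
  apply/(measurable_restrictT _ _).1 => //.
  apply: measurable_funTS; apply: continuous_measurable_fun. exact: continuous_monomial_gauss.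
by apply/funext => x; exact: chi_unnormE.
Qed.

Lemma integral_chi_unnorm n k :
  (\int[mu]_x (x ^+ k * chi_unnorm n x)%:E = gauss_moment (n.-1 + k))%E.
Proof.
rewrite /gauss_moment [RHS]integral_mkcond; apply: eq_integral => x _.
rewrite chi_unnormE !patchE; case: ifP => _; last by rewrite mulr0.
by rewrite mulrA addnC exprD.
Qed.

Lemma chi_even_moment n k :
  (forall B, measurable B -> P (X @^-1` B) = (\int[mu]_(r in B) (chi_pdf n.+1 r)%:E)%E) ->
  (\int[P]_w (X w ^+ k.*2)%:E = (double_rising n.+1%:R k)%:E)%E.
Proof.
move=> lawX; set Z := fine (\int[mu]_(t in [set: R]) (chi_unnorm n.+1 t)%:E)%E.
have Z0 : 0 <= Z by rewrite fine_ge0// integral_ge0// => x _; rewrite lee_fin chi_unnorm_ge0.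
have EX j : (\int[P]_w (X w ^+ j.*2)%:E = Z^-1%:E * gauss_moment (n + j.*2))%E.
  rewrite (@ge0_integral_density _ _ _ _ X (@chi_pdf R n.+1) _ _ _ (fun x => x ^+ j.*2))//.
  - rewrite -[n in (n + _)%N]/(n.+1.-1) -integral_chi_unnorm -ge0_integralZl_EFin//=.
    + by apply: eq_integral => x _; rewrite -!EFinM; congr EFin; rewrite /chi_pdf -/Z mulrA mulrC.
    + by move=> x _; rewrite lee_fin mulr_ge0// chi_unnorm_ge0.
    + by apply/measurable_EFinP/measurable_funM; [exact: measurable_funX|exact: measurable_chi_unnorm].
    + by rewrite invr_ge0.
  - by move=> x; rewrite divr_ge0 ?chi_unnorm_ge0.
  - by apply: measurable_funM => //; exact: measurable_chi_unnorm.
rewrite EX gauss_moment_double muleCA.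
(* Total mass 1 normalizes, so the junk value [fine +oo = 0] of [Z] cannot occur. *)
have := EX 0%N; rewrite addn0 => <-.
by rewrite (eq_integral (cst 1%E))// integral_cst//= probability_setT !mule1.
Qed.

Lemma normal_pdf01E (x : R) : normal_pdf 0 1 x = normal_peak 1 * expR (- x ^+ 2 / 2).
Proof.
by rewrite normal_pdfE ?oner_eq0// /normal_fun subr0 expr1n.
Qed.

Hypothesis lawX : forall B, measurable B -> P (X @^-1` B) = normal_prob 0 1 B.

Lemma normal_ge0_integral (f : R -> R) :
  measurable_fun setT f -> (forall x, 0 <= f x) ->
  (\int[P]_w (f (X w))%:E = \int[mu]_x ((f x)%:E * (normal_pdf 0 1 x)%:E))%E.
Proof.
move=> mf f0; apply: ge0_integral_density => //.
  by move=> x; exact: normal_pdf_ge0.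
exact: measurable_normal_pdf.
Qed.

Lemma normal_even_moment k :
  (\int[P]_w (X w ^+ k.*2)%:E = (double_rising 1 k)%:E)%E.
Proof.
have EX j : (\int[P]_w (X w ^+ j.*2)%:E = (normal_peak 1)%:E * (2%:E * gauss_moment j.*2))%E.
  rewrite (@normal_ge0_integral (fun x => x ^+ j.*2))//.
  rewrite [X in (_ * X)%E](_ : _ = \int[mu]_x (x ^+ j.*2 * expR (- x ^+ 2 / 2))%:E)%E.
    rewrite -ge0_integralZl_EFin//=.
    - by apply: eq_integral => x _; rewrite -!EFinM normal_pdf01E mulrCA.
    - by move=> x _; rewrite lee_fin mulr_ge0 ?expR_ge0.
    - apply/measurable_EFinP; apply: continuous_measurable_fun.
      exact: continuous_monomial_gauss.
    - exact: normal_peak_ge0.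
  rewrite ge0_symfun_integralT//.
  - by rewrite /gauss_moment set_itvcy.
  - by move=> x; rewrite mulr_ge0 ?expR_ge0.
  - exact: continuous_monomial_gauss.
  - by move=> x /=; rewrite sqrrN exprNn -signr_odd odd_double expr0 mul1r.
have := gauss_moment_double 0 k; rewrite add0n => Hk.
have rot (a b c e : \bar R) : (a * (b * (c * e)) = c * (a * (b * e)))%E.
  by rewrite [RHS]muleCA; congr (a * _)%E; rewrite muleCA.
rewrite EX Hk rot.
(* The moment of order 0 is 1, which fixes the normalizing factor without evaluating the Gaussian
   integral. *)
have := EX 0%N; rewrite double0 => <-.
by rewrite (eq_integral (cst 1%E))// integral_cst//= probability_setT !mule1.
Qed.

Lemma normal_symmetric (f : R -> R) :
  measurable_fun setT f -> (forall x, 0 <= f x) ->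
  (\int[P]_w (f (- X w))%:E = \int[P]_w (f (X w))%:E)%E.
Proof.
move=> mf f0.
have mN : measurable_fun setT (-%R : measurableTypeR R -> measurableTypeR R).
  by apply: continuous_measurable_fun; exact: opp_continuous.
have mfN : measurable_fun setT (fun x : R => f (- x)) by exact: (measurableT_comp mf).
rewrite (normal_ge0_integral mfN)// normal_ge0_integral//.
have mg : measurable_fun setT (fun x : measurableTypeR R => ((f x)%:E * (normal_pdf 0 1 x)%:E)%E).
  apply: emeasurable_funM; apply/measurable_EFinP => //.
  exact: measurable_normal_pdf.
transitivity (\int[pushforward mu (-%R : measurableTypeR R -> measurableTypeR R)]_x
   ((f x)%:E * (normal_pdf 0 1 x)%:E))%E.
  rewrite (ge0_integral_pushforward mN)//=.
    by rewrite preimage_setT; apply: eq_integral => x _; rewrite !normal_pdf01E sqrrN.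
  by move=> y _; rewrite mule_ge0// lee_fin ?normal_pdf_ge0.
by apply: eq_measure_integral => A mA _; exact: lebesgue_measureN.
Qed.

Lemma normal_cos (t : R) :
  (\int[P]_w (cos (t * X w))%:E = (expR (- t ^+ 2 / 2))%:E)%E.
Proof.
have mX : measurable_fun setT X by exact: measurable_funP.
apply: integral_cos_gauss_moments; first exact: measurable_funM.
move=> k; rewrite EFinM -normal_even_moment -ge0_integralZl_EFin//=.
- by apply: eq_integral => w _; rewrite exprMn -exprM mul2n.
- by move=> w _; rewrite lee_fin.
- by apply/measurable_EFinP/measurable_funX.
- by rewrite exprn_ge0// sqr_ge0.
Qed.

(** The symmetry of the law is available for nonnegative functions only, so it is applied to 1 + sin
    (t x); this gives 1 - r = 1 + r for the finite mean r of the sine. *)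
Lemma normal_sin (t : R) : (\int[P]_w (sin (t * X w))%:E = 0)%E.
Proof.
have mX : measurable_fun setT X by exact: measurable_funP.
have msin : measurable_fun setT (fun x : R => sin (t * x)).
  apply: measurableT_comp; first by apply: continuous_measurable_fun; exact: continuous_sin.
  exact: measurable_funM.
have int_sin (c : R) : P.-integrable setT (fun w => (c * sin (t * X w))%:E).
  apply: (@measurable_bounded_integrable _ _ _ P (fun w => c * sin (t * X w))) => //.
  - by apply: (le_lt_trans (probability_le1 P measurableT)); rewrite ltry.
  - by apply: measurable_funM => //; exact: (measurableT_comp msin mX).
  - exists `|c|; split => [|x Mx w _]; first exact: num_real.
    rewrite /= (le_trans _ (ltW Mx))// normrM ler_piMr// ler_norml.
    by rewrite sin_geN1 sin_le1.
have int1 : P.-integrable setT (fun w => (1 : R)%:E).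
  exact: finite_measure_integrable_cst.
have int1s c : (\int[P]_w (1 + c * sin (t * X w))%:E = 1 + c%:E * \int[P]_w (sin (t * X w))%:E)%E.
  under eq_integral do rewrite EFinD.
  rewrite integralD//= integral_cst//= probability_setT mul1e; congr (_ + _)%E.
  under eq_integral do rewrite EFinM.
  rewrite integralZl//=.
  by have := int_sin 1; under eq_fun do rewrite mul1r.
have sin_fin : (\int[P]_w (sin (t * X w))%:E)%E \is a fin_num.
  by have /integrable_fin_num := int_sin 1; under eq_integral do rewrite mul1r; apply.
have m1 : measurable_fun setT (fun x : R => 1 + sin (t * x)) by exact: measurable_funD.
have ge01 x : 0 <= 1 + sin (t * x) by rewrite -lerBlDl sub0r sin_geN1.
have sym := normal_symmetric m1 ge01.
have eN : (\int[P]_w (1 + sin (t * - X w))%:E = \int[P]_w (1 + -1 * sin (t * X w))%:E)%E.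
  by apply: eq_integral => w _; rewrite mulrN sinN mulN1r.
have eP : (\int[P]_w (1 + sin (t * X w))%:E = \int[P]_w (1 + 1 * sin (t * X w))%:E)%E.
  by apply: eq_integral => w _; rewrite mul1r.
move: sym; rewrite eN eP !int1s -(fineK sin_fin) -!EFinM -!EFinD => -[].
by move: (fine _) => r ?; congr EFin; lra.
Qed.

End chi_and_normal_moments.

(** * Linear combinations of independent standard normal variables *)

Section iid_normal.
Context {R : realType} (I : finType) d (T : measurableType d) (P : probability T R).
Variable G : I -> {RV P >-> R}.
Hypothesis G_indep : mutually_independent P (fun i => G i : T -> R).
Hypothesis G_law : forall i (B : set R), measurable B ->
  P (G i @^-1` B) = normal_prob 0 1 B.

Lemma measurable_cos_sum (d' : measure_display) (T' : measurableType d') (s : seq I)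
    (c : I -> R) (f : I -> T' -> R) : (forall i, measurable_fun setT (f i)) ->
  measurable_fun setT (fun x => cos (\sum_(i <- s) c i * f i x)).
Proof.
move=> mf; apply: (measurableT_comp (f := @cos R)).
  by apply: continuous_measurable_fun; exact: continuous_cos.
by apply: measurable_sum => i; exact: measurable_funM.
Qed.

(** Induction on the list: the head is split off by independence and the cosine of the sum expanded.
    The sine term vanishes because the head has zero sine mean, whatever the sine mean [S] of the
    tail. By [uniq] the tail avoids the head, so all of it is read from the second copy. *)
Lemma iid_normal_cos_seq (c : I -> R) (s : seq I) : uniq s ->
  (\int[P]_w (cos (\sum_(i <- s) c i * G i w))%:E =
   (expR (- (\sum_(i <- s) c i ^+ 2) / 2))%:E)%E.
Proof.
have mG i : measurable_fun setT (G i) by exact: measurable_funP.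
elim: s => [|e s IHs] /=.
  move=> _; under eq_integral do rewrite big_nil cos0.
  by rewrite big_nil oppr0 mul0r expR0 integral_cst//= probability_setT mule1.
move=> /andP[es us].
have sp := mutually_independent_splits (pred1 e) G_indep.
pose L v := \sum_(i <- s) c i * G i v.
have mL : measurable_fun setT L by apply: measurable_sum => i; exact: measurable_funM.
have mcosL : measurable_fun setT (fun v => cos (L v)) by exact: measurable_cos_sum.
have msin : measurable_fun setT (@sin R).
  by apply: continuous_measurable_fun; exact: continuous_sin.
have bounded_int (g : T -> R) : measurable_fun setT g -> (forall w, `|g w| <= 1) ->
    P.-integrable setT (EFin \o g).
  move=> mg g1; apply: measurable_bounded_integrable => //.
    by apply: (le_lt_trans (probability_le1 P measurableT)); rewrite ltry.
  by exists 1; split => // x x1 w _; rewrite /= (le_trans (g1 w))// ltW.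
have cos1 (x : R) : `|cos x| <= 1 by rewrite ler_norml cos_geN1 cos_le1.
have sin1 (x : R) : `|sin x| <= 1 by rewrite ler_norml sin_geN1 sin_le1.
have int_cosL : P.-integrable setT (fun v => (cos (L v))%:E) by exact: bounded_int.
have int_sinL : P.-integrable setT (fun v => (sin (L v))%:E).
  by apply: (bounded_int (fun v => sin (L v))) => //; exact: measurableT_comp.
have mcG : measurable_fun setT (fun u => c e * G e u) by exact: measurable_funM.
have int_cosG : P.-integrable setT (fun v => (cos (c e * G e v))%:E).
  by apply: (bounded_int (fun v => cos (c e * G e v))) => //; apply: measurableT_comp mcG;
   apply: continuous_measurable_fun; exact: continuous_cos.
have int_sinG : P.-integrable setT (fun v => (sin (c e * G e v))%:E).
  by apply: (bounded_int (fun v => sin (c e * G e v))) => //; exact: measurableT_comp.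
have mh : measurable_fun [set: famType R I] (fun f => cos (\sum_(i <- e :: s) c i * f i)).
  by apply: measurable_cos_sum => i; exact: measurable_fam_coord.
rewrite (splits_integral mG sp mh (fun=> cos1 _)).
pose S := fine (\int[P]_v (sin (L v))%:E)%E.
transitivity (\int[P]_u ((cos (c e * G e u))%:E * (\int[P]_v (cos (L v))%:E) -
    (sin (c e * G e u))%:E * S%:E))%E.
  apply: eq_integral => u _.
  rewrite fineK; last exact: integrable_fin_num.
  rewrite -!integralZl//= -integralB//=; [|exact: integrableZl..].
  apply: eq_integral => v _; rewrite -!EFinM -EFinB -cosD; congr (cos _)%:E.
  rewrite big_cons /mergefam/= eqxx; congr (_ + _); apply: eq_big_seq => i si.
  by rewrite ifF//; apply/eqP => ie; rewrite -ie si in es.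
rewrite IHs// integralB//=; [|exact: integrableZr..].
rewrite integralZr// integralZr// normal_cos; last exact: G_law.
rewrite normal_sin; last exact: G_law.
by rewrite mul0e sube0 -EFinM -expRD big_cons -mulrDl opprD.
Qed.

Lemma iid_normal_cos (c : I -> R) :
  (\int[P]_w (cos (\sum_i c i * G i w))%:E = (expR (- (\sum_i c i ^+ 2) / 2))%:E)%E.
Proof. exact/iid_normal_cos_seq/index_enum_uniq. Qed.

End iid_normal.

(** * Haar-distributed orthogonal matrices *)

Section linear_algebra.
Context {R : realType}.

(** A nonzero difference would have the roots 0, 1, 2, ..., as many as its size, which is one too
    many. This justifies comparing coefficients in [haar_mixed2]. *)
Lemma horner_ext (p q : {poly R}) : (forall x, p.[x] = q.[x]) -> p = q.
Proof.
move=> pq; apply/eqP; rewrite -subr_eq0; apply: contraT => pq0.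
pose s := [seq i%:R : R | i <- iota 0 (size (p - q))].
have : (size s < size (p - q)%R)%N.
  apply: max_poly_roots => //.
    by apply/allP => x _; rewrite /root hornerD hornerN pq subrr.
  by rewrite map_inj_uniq ?iota_uniq//; exact: mulrIn (oner_neq0 R).
by rewrite size_map size_iota ltnn.
Qed.

(* Householder reflection in the hyperplane orthogonal to [p - q]. *)
Lemma orthogonal_mx_transitive n (p q : 'rV[R]_n) : p *m p^T = q *m q^T ->
  exists2 U : 'M[R]_n, orthogonal_mx U & p *m U = q.
Proof.
move=> pq; pose v := p - q; pose c := (v *m v^T) 0 0.
have vv : v *m v^T = c%:M by rewrite [LHS]mx11_scalar.
have [c0|c0] := eqVneq c 0.
  exists 1%:M; first by rewrite /orthogonal_mx trmx1 mulmx1.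
  rewrite mulmx1; apply/eqP; rewrite -subr_eq0 -/v; apply/eqP/rowP => i.
  have cE : c = \sum_j v 0 j ^+ 2.
    by rewrite /c mxE; apply: eq_bigr => j _; rewrite [v^T _ _]mxE expr2.
  move: c0; rewrite cE => /eqP; rewrite psumr_eq0; last by move=> j _; exact: sqr_ge0.
  by move=> /allP/(_ i (mem_index_enum _)); rewrite sqrf_eq0 => /eqP ->; rewrite mxE.
pose N := v^T *m v.
have NN : N *m N = c *: N.
  by rewrite /N -mulmxA (mulmxA v) vv mul_scalar_mx -scalemxAr.
have NT : N^T = N by rewrite /N trmx_mul trmxK.
exists (1%:M - (2 / c) *: N).
  have UT : (1%:M - (2 / c) *: N)^T = 1%:M - (2 / c) *: N.
    by rewrite [LHS]raddfB/= trmx1 [X in _ - X]linearZ/= NT.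
  rewrite /orthogonal_mx UT; apply/eqP.
  rewrite mulmxBl mul1mx mulmxBr mulmx1 -scalemxAl -scalemxAr NN !scalerA.
  rewrite -mulrA divfK// mulr_natr -scalerMnl mulr2n; move: ((2 / c) *: N) => A.
  by rewrite opprB addrK subrK.
(* Since [p] and [q] have the same length, |p - q|^2 = 2 <p, p - q>. The reflection therefore
   subtracts exactly [v] from [p]. *)
have pv : p *m v^T = (c / 2)%:M.
  have : c%:M = p *m v^T + p *m v^T.
    rewrite -vv /v mulmxBl linearB/= !mulmxBr pq.
    have -> : q *m p^T = p *m q^T.
      by rewrite [RHS]mx11_scalar -tr_scalar_mx -mx11_scalar trmx_mul trmxK.
    by rewrite opprB addrCA addrA.
  move=> h; rewrite [LHS]mx11_scalar; congr (_%:M).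
  have := congr1 (fun A : 'M[R]_1 => A 0 0) h; rewrite !mxE eqxx mulr1n; lra.
rewrite mulmxBr mulmx1 -scalemxAr mulmxA pv mul_scalar_mx scalerA.
have -> : 2 / c * (c / 2) = 1 by field.
by rewrite scale1r /v opprB addrC subrK.
Qed.

Definition two_point n (i j : 'I_n) (a b : R) l :=
  if l == i then a else if l == j then b else 0.

(** [F] is left general to cover both the squared length of a two-point vector and the linear forms
    that it defines. *)
Lemma sum_two_point n (i j : 'I_n) (a b : R) (F : R -> 'I_n -> R) : i != j ->
  (forall l, F 0 l = 0) -> \sum_l F (two_point i j a b l) l = F a i + F b j.
Proof.
move=> ij F0; have ji : j != i by rewrite eq_sym.
rewrite (bigD1 i)//= (bigD1 j)//= /two_point eqxx (negbTE ji) eqxx.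
by rewrite big1 ?addr0// => l /andP[/negbTE -> /negbTE ->].
Qed.

(** Allows a single feature to be treated as a pair whose second coefficient is 0. *)
Lemma exists_other n (i : 'I_n.+2) : exists j, i != j.
Proof. by have [->|i0] := eqVneq i ord0; [exists ord_max|exists ord0]. Qed.

End linear_algebra.

(** * Rotation invariance of the moments of [Q v] *)

Section haar_moments.
Context {R : realType} d (T : measurableType d) (P : probability T R) (n : nat).
Variables (Q : 'I_n * 'I_n -> {RV P >-> R}) (v : 'I_n -> R) (i0 : 'I_n).
Hypothesis Q_haar : haar_orthogonal P (fun w => \matrix_(j, k) Q (j, k) w).

Let Qm w : 'M[R]_n := \matrix_(j, k) Q (j, k) w.
Let mQ i : measurable_fun setT (Q i). Proof. exact: measurable_funP. Qed.

Lemma haar_ge0_integral (U : 'M[R]_n) (h : famType R ('I_n * 'I_n)%type -> \bar R) :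
  orthogonal_mx U -> measurable_fun setT h -> (forall f, 0 <= h f)%E ->
  (\int[P]_w h (fun jk => (U *m Qm w) jk.1 jk.2) = \int[P]_w h (Q ^~ w))%E.
Proof.
move=> oU mh h0.
have mUQ jk : measurable_fun setT (fun w => (U *m Qm w) jk.1 jk.2).
  rewrite (_ : (fun w => _) = fun w => \sum_l U jk.1 l * Q (l, jk.2) w).
    by apply: measurable_sum => l; exact: measurable_funM.
  by apply/funext => w; rewrite mxE; apply: eq_bigr => l _; rewrite mxE.
apply: (same_law_ge0_integral mUQ mQ) => // B mB.
have := Q_haar.2 U oU (fun j k => B (j, k)) (fun j k => mB (j, k)).
rewrite (_ : [set w | forall j k, B (j, k) ((U *m _) j k)] =
             [set w | forall jk, B jk ((U *m Qm w) jk.1 jk.2)]); last first.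
  apply/seteqP; split => w /= h'; first by case.
  by move=> j k; exact: (h' (j, k)).
move=> ->; congr (P _); apply/seteqP; split => w /= h'; last first.
  by move=> j k; rewrite mxE; exact: h'.
by case=> j k; have := h' j k; rewrite mxE.
Qed.

Definition haar_proj i w := \sum_j Q (i, j) w * v j.
Local Notation u := haar_proj.

Lemma measurable_haar_proj i : measurable_fun setT (u i).
Proof. by apply: measurable_sum => j; exact: measurable_funM. Qed.

(** Left multiplication of [Q] by [U] replaces the row vector [p] by [p U] in <p, Q v>, and [U] can
    be chosen to carry [p] to [q]. *)
Lemma haar_proj_invariant (p q : 'I_n -> R) k :
  \sum_i p i ^+ 2 = \sum_i q i ^+ 2 ->
  (\int[P]_w ((\sum_i p i * u i w) ^+ k.*2)%:E =
   \int[P]_w ((\sum_i q i * u i w) ^+ k.*2)%:E)%E.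
Proof.
move=> pq.
have normE (r : 'I_n -> R) : (\row_i r i) *m (\row_i r i)^T = (\sum_i r i ^+ 2)%:M.
  apply/rowP => j; rewrite ord1 !mxE eqxx mulr1n.
  by apply: eq_bigr => i _; rewrite !mxE expr2.
have [|U oU /rowP pU] := @orthogonal_mx_transitive R n (\row_i p i) (\row_i q i).
  by rewrite !normE pq.
pose h (f : famType R ('I_n * 'I_n)%type) : \bar R :=
  ((\sum_i p i * \sum_j f (i, j) * v j) ^+ k.*2)%:E.
have mh : measurable_fun setT h.
  apply/measurable_EFinP/measurable_funX; apply: measurable_sum => i.
  apply: measurable_funM => //; apply: measurable_sum => j.
  by apply: measurable_funM => //; exact: measurable_fam_coord.
have h0 f : (0 <= h f)%E by rewrite lee_fin exprn_even_ge0 ?odd_double.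
have := haar_ge0_integral oU mh h0.
rewrite /h /= => <-; apply: eq_integral => w _; congr (_ ^+ _)%:E.
transitivity (\sum_i \sum_l p i * U i l * u l w).
  apply: eq_bigr => i _; rewrite /u big_distrr/=.
  under eq_bigr => j _ do rewrite mxE big_distrl big_distrr/=.
  rewrite exchange_big/=; apply: eq_bigr => l _.
  by rewrite big_distrr/=; apply: eq_bigr => j _; rewrite mxE !mulrA.
rewrite exchange_big/=; apply: eq_bigr => l _; rewrite -big_distrl/=; congr (_ * _).
by have := pU l; rewrite !mxE => <-; apply: eq_bigr => i _; rewrite mxE.
Qed.

Definition haar_moment k : \bar R := (\int[P]_w (u i0 w ^+ k.*2)%:E)%E.

(** By invariance [p] may be replaced by the vector of the same length along the axis [i0]. *)
Lemma haar_proj_moment (p : 'I_n -> R) k :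
  (\int[P]_w ((\sum_i p i * u i w) ^+ k.*2)%:E =
   ((\sum_i p i ^+ 2) ^+ k)%:E * haar_moment k)%E.
Proof.
pose r := Num.sqrt (\sum_i p i ^+ 2).
have rr : r ^+ 2 = \sum_i p i ^+ 2 by rewrite sqr_sqrtr// sumr_ge0// => i _; exact: sqr_ge0.
rewrite (@haar_proj_invariant p (fun i => if i == i0 then r else 0)); last first.
  rewrite -rr [RHS](bigD1 i0)//= eqxx big1 ?addr0// => i /negbTE ->; exact: expr0n.
rewrite -rr -exprM mul2n /haar_moment -ge0_integralZl_EFin//=.
- apply: eq_integral => w _; rewrite -EFinM -exprMn; congr (_ ^+ _)%:E.
  by rewrite (bigD1 i0)//= eqxx big1 ?addr0// => i /negbTE ->; rewrite mul0r.
- by move=> w _; rewrite lee_fin exprn_even_ge0 ?odd_double.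
- by apply/measurable_EFinP/measurable_funX; exact: measurable_haar_proj.
- by rewrite exprn_even_ge0 ?odd_double.
Qed.

Lemma haar_proj_norm : {ae P, forall w, \sum_i u i w ^+ 2 = \sum_j v j ^+ 2}.
Proof.
apply: filterS Q_haar.1 => w /eqP /mulmx1C oQ.
pose V : 'cV[R]_n := \col_j v j.
have uE i : u i w = (Qm w *m V) i 0.
  by rewrite mxE; apply: eq_bigr => j _; rewrite !mxE.
have -> : \sum_i u i w ^+ 2 = ((Qm w *m V)^T *m (Qm w *m V)) 0 0.
  by rewrite [RHS]mxE; apply: eq_bigr => i _; rewrite [(_^T) _ _]mxE -uE expr2.
rewrite trmx_mul mulmxA -(mulmxA V^T) oQ mulmx1 mxE.
by apply: eq_bigr => j _; rewrite !mxE expr2.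
Qed.

End haar_moments.

(** * Values of the moments of one coordinate of [Q v] *)

Section haar_moment_values.
Context {R : realType} d (T : measurableType d) (P : probability T R) (n : nat).
Variables (Q : 'I_n * 'I_n -> {RV P >-> R}) (v : 'I_n -> R) (i0 : 'I_n).
Hypothesis Q_haar : haar_orthogonal P (fun w => \matrix_(j, k) Q (j, k) w).
Local Notation u := (haar_proj Q v).
Local Notation zz := (\sum_j v j ^+ 2).

Lemma ae_bounded_integrable (f : T -> R) C : 0 <= C -> measurable_fun setT f ->
  {ae P, forall w, `|f w| <= C} -> P.-integrable setT (EFin \o f).
Proof.
move=> C0 mf fC; apply/integrableP; split; first exact/measurable_EFinP.
apply: (@le_lt_trans _ _ (C%:E * P setT)%E); last by rewrite probability_setT mule1 ltry.
apply: integral_le_bound => //; first exact/measurable_EFinP.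
by apply: filterS fC => w fC _; rewrite lee_fin.
Qed.

(** Almost surely each coordinate of [u] is at most |v| in absolute value, so mixed monomials, which
    may change sign, are integrable and powers of sums can be expanded under the integral. *)
Lemma haar_monomial_integrable i j a b :
  P.-integrable setT (fun w => (u i w ^+ a * u j w ^+ b)%:E).
Proof.
apply: (@ae_bounded_integrable _ (Num.sqrt zz ^+ a * Num.sqrt zz ^+ b)).
- by rewrite mulr_ge0 ?exprn_ge0 ?sqrtr_ge0.
- by apply: measurable_funM; apply: measurable_funX; exact: measurable_haar_proj.
apply: filterS (haar_proj_norm v Q_haar) => w uz.
have ub l : `|u l w| <= Num.sqrt zz.
  rewrite -sqrtr_sqr ler_wsqrtr// -uz (bigD1 l)//= lerDl.
  by apply: sumr_ge0 => *; exact: sqr_ge0.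
by rewrite normrM !normrX ler_pM ?exprn_ge0// lerXn2r ?nnegrE ?sqrtr_ge0.
Qed.

Lemma coef2_addXn2 k : ((1 + 'X^2) ^+ k : {poly R})`_2 = k%:R.
Proof.
suff : ((1 + 'X^2) ^+ k : {poly R})`_0 = 1 /\ ((1 + 'X^2) ^+ k : {poly R})`_2 = k%:R by case.
elim: k => [|k [IH0 IH2]]; first by rewrite expr0 !coefC.
rewrite exprS mulrDl mul1r !coefD !coefXnM/= IH0 IH2 addr0.
by rewrite natr1.
Qed.

Definition haar_mixed a j b := fine (\int[P]_w (u i0 w ^+ a * u j w ^+ b)%:E)%E.

Lemma haar_mixedE a j b :
  (\int[P]_w (u i0 w ^+ a * u j w ^+ b)%:E = (haar_mixed a j b)%:E)%E.
Proof. by rewrite fineK//; apply: integrable_fin_num => //; exact: haar_monomial_integrable. Qed.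

Definition haar_even k := fine (haar_moment Q v i0 k).

Lemma haar_evenE k : haar_moment Q v i0 k = (haar_even k)%:E.
Proof.
rewrite fineK//; have := haar_monomial_integrable i0 i0 k.*2 0.
by move=> /integrable_fin_num; rewrite /haar_moment; under eq_integral do rewrite expr0 mulr1; apply.
Qed.

(* This is the coefficient of [b ^+ 2] in
   [E (u i0 + b u j)^(2k+2) = (1 + b^2)^(k+1) E (u i0)^(2k+2)]. *)
Lemma haar_mixed2 k j : j != i0 ->
  haar_mixed k.*2 j 2 = haar_even k.+1 / (k.*2.+1)%:R.
Proof.
move=> ji0; pose N := k.+1.*2.
have expand b : (1 + b ^+ 2) ^+ k.+1 * haar_even k.+1 =
    \sum_(l < N.+1) 'C(N, l)%:R * haar_mixed (N - l) j l * b ^+ l.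
  have i0j : i0 != j by rewrite eq_sym.
  have := @haar_proj_moment _ _ _ _ _ Q v i0 Q_haar (two_point i0 j 1 b) k.+1.
  rewrite (sum_two_point (F := fun x _ => x ^+ 2) _ _ i0j); last by move=> _; rewrite expr0n.
  rewrite haar_evenE expr1n -EFinM => H; apply: EFin_inj; rewrite -H.
  transitivity (\int[P]_w (\sum_(l < N.+1)
      ('C(N, l)%:R * b ^+ l)%:E * (u i0 w ^+ (N - l) * u j w ^+ l)%:E))%E.
    apply: eq_integral => w _.
    rewrite (sum_two_point (F := fun x i => x * u i w) _ _ i0j); last by move=> i; rewrite mul0r.
    rewrite mul1r exprDn -sumEFin; apply: eq_bigr => l _.
    by rewrite -EFinM exprMn -mulr_natl; congr EFin; ring.
  rewrite integral_sum//=; last first.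
    by move=> l; apply: integrableZl => //; exact: haar_monomial_integrable.
  rewrite -sumEFin; apply: eq_bigr => l _.
  rewrite integralZl//; last exact: haar_monomial_integrable.
  by rewrite haar_mixedE -EFinM mulrAC.
have : haar_even k.+1 *: (1 + 'X^2) ^+ k.+1 =
    \poly_(l < N.+1) ('C(N, l)%:R * haar_mixed (N - l) j l).
  apply: horner_ext => b; rewrite horner_poly -expand.
  by rewrite hornerZ horner_exp hornerD hornerC hornerXn mulrC.
move=> /(congr1 (fun p : {poly R} => p`_2)).
rewrite coefZ coef2_addXn2 coef_poly ltnS /N doubleS ltnS ltn0Sn subSS subSS subn0.
(* The factor k+1 cancels the coefficient of degree 2 of (1 + X^2)^(k+1) and leaves the denominator
   2k+1. *)
have -> : 'C(k.*2.+2, 2)%:R = k.+1%:R * k.*2.+1%:R :> R.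
  by rewrite bin2 -[k.*2.+2.-1]/(k.*2.+1) -doubleS -doubleMl doubleK natrM.
move=> H.
have k0 : k.+1%:R != 0 :> R by rewrite pnatr_eq0.
have k1 : k.*2.+1%:R != 0 :> R by rewrite pnatr_eq0.
by apply: (mulIf k1); rewrite divfK//; apply: (mulIf k0); rewrite H; ring.
Qed.

(** Multiplying u_i0^(2k) by |u|^2 = |v|^2 and taking means gives zz e_k = e_(k+1) + (n-1) e_(k+1) /
    (2k+1): the index [i0] yields the first term, each other index the share found in
    [haar_mixed2]. *)
Lemma haar_even_rec k :
  haar_even k.+1 * (n%:R + 2 * k%:R) = zz * haar_even k * (1 + 2 * k%:R).
Proof.
have k1 : (k.*2.+1)%:R = 1 + 2 * k%:R :> R by rewrite -natr1 -mul2n natrM addrC.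
have Ek : zz * haar_even k = \sum_j haar_mixed k.*2 j 2.
  apply: EFin_inj; rewrite EFinM -haar_evenE /haar_moment -integralZl//; last first.
    have := haar_monomial_integrable i0 i0 k.*2 0.
    by under eq_fun do rewrite expr0 mulr1.
  transitivity (\int[P]_w (\sum_j (u i0 w ^+ k.*2 * u j w ^+ 2)%:E))%E.
    apply: ae_eq_integral => //.
    - apply: emeasurable_funM => //; apply/measurable_EFinP/measurable_funX.
      exact: measurable_haar_proj.
    - apply: emeasurable_sum => j; apply: (measurable_int P).
      exact: haar_monomial_integrable.
    apply: filterS (haar_proj_norm v Q_haar) => w uz _.
    by rewrite sumEFin -big_distrr/= uz mulrC EFinM.
  rewrite integral_sum//=; last by move=> j; exact: haar_monomial_integrable.
  by rewrite -sumEFin; apply: eq_bigr => j _; rewrite haar_mixedE.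
have E0 : haar_mixed k.*2 i0 2 = haar_even k.+1.
  by congr fine; apply: eq_integral => w _; rewrite -exprD addn2 doubleS.
rewrite Ek (bigD1 i0)//= E0.
rewrite (eq_bigr (fun=> haar_even k.+1 / (k.*2.+1)%:R)); last first.
  by move=> j ji0; exact: haar_mixed2.
rewrite sumr_const cardC1 card_ord -mulr_natr k1.
have n0 : (0 < n)%N by exact: leq_ltn_trans (ltn_ord i0).
rewrite -{1}(prednK n0) -natr1; field.
by rewrite gt_eqF// ltr_pwDl// mulr_ge0.
Qed.

Lemma haar_even_prod k :
  haar_even k * double_rising n%:R k = zz ^+ k * double_rising 1 k.
Proof.
elim: k => [|k IHk].
  rewrite !double_rising0 !mulr1 expr0 /haar_even /haar_moment.
  by under eq_integral do rewrite expr0; rewrite integral_cst//= probability_setT mule1.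
rewrite !double_risingS mulrCA mulrA [X in X * _]mulrC.
rewrite mulrAC haar_even_rec exprS.
transitivity (zz * (1 + 2 * k%:R) * (haar_even k * double_rising n%:R k)).
  by ring.
by rewrite IHk; ring.
Qed.

End haar_moment_values.

(** * Orthogonal random features *)

Section orf.
Context {R : realType} d (T : measurableType d) (P : probability T R) (n : nat).
Variables (s : 'I_n.+2 -> {RV P >-> R}) (Q : 'I_n.+2 * 'I_n.+2 -> {RV P >-> R}).
Variable v : 'I_n.+2 -> R.
Hypothesis s_indep : mutually_independent P (fun i => s i : T -> R).
Hypothesis s_law : forall i (B : set R), measurable B ->
  P (s i @^-1` B) = (\int[@lebesgue_measure R]_(r in B) (chi_pdf n.+2 r)%:E)%E.
Hypothesis Q_haar : haar_orthogonal P (fun w => \matrix_(j, k) Q (j, k) w).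
Hypothesis sQ_indep : independent_vectors P (fun i => s i : T -> R) (fun jk => Q jk : T -> R).
Local Notation u := (haar_proj Q v).
Local Notation zz := (\sum_j v j ^+ 2).
Local Notation N := (n.+2%:R : R).

Let ms i : measurable_fun setT (s i). Proof. exact: measurable_funP. Qed.
Let mQ i : measurable_fun setT (Q i). Proof. exact: measurable_funP. Qed.
Let even_ge0 k (x : R) : 0 <= x ^+ k.*2.
Proof. by rewrite exprn_even_ge0 ?odd_double. Qed.

(** Radii and matrix entries form one family over a sum type, so that the independence of [s] and
    [Q] becomes an instance of [splits]. *)
Let X (e : 'I_n.+2 + 'I_n.+2 * 'I_n.+2) : T -> R :=
  match e with inl i => s i | inr jk => Q jk end.

Let mX e : measurable_fun setT (X e). Proof. by case: e => ?; [exact: ms|exact: mQ]. Qed.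

Lemma radius_direction_splits : splits P X (fun e => if e is inl _ then true else false).
Proof.
move=> B mB; have := sQ_indep (fun i => mB (inl i)) (fun jk => mB (inr jk)).
rewrite (_ : _ `&` _ = [set w | forall e, B e (X e w)]).
  move=> ->; congr (P _ * P _)%E; apply/seteqP; split => w /= h e.
  - by case: e => // i _; exact: h.
  - by move=> _; exact: (h (inl e)).
  - by case: e => // jk _; exact: h.
  - by move=> _; exact: (h (inr e)).
apply/seteqP; split => w /=.
  by move=> [h1 h2] [i|jk]; [exact: (h1 i)|exact: (h2 jk)].
by move=> h; split => e _; [exact: (h (inl e))|exact: (h (inr e))].
Qed.

Lemma chi_product_moment i j a b : i != j ->
  (\int[P]_w (s i w ^+ a.*2 * s j w ^+ b.*2)%:E =
   (double_rising N a * double_rising N b)%:E)%E.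
Proof.
move=> ij; have sp := mutually_independent_splits (pred1 i) s_indep.
pose h (f : famType R 'I_n.+2) : \bar R := (f i ^+ a.*2 * f j ^+ b.*2)%:E.
have mh : measurable_fun setT h.
  apply/measurable_EFinP/measurable_funM; apply: measurable_funX; exact: measurable_fam_coord.
have h0 f : (0 <= h f)%E by rewrite lee_fin mulr_ge0.
rewrite (splits_ge0_integral ms sp mh h0).
transitivity (\int[P]_w ((s i w ^+ a.*2)%:E * (double_rising N b)%:E))%E.
  apply: eq_integral => w _; rewrite -(chi_even_moment b (@s_law j)).
  rewrite -ge0_integralZl_EFin//=.
  - by apply: eq_integral => t _; rewrite /h /mergefam/= eqxx eq_sym (negbTE ij) EFinM.
  - by move=> t _; rewrite lee_fin.
  - by apply/measurable_EFinP/measurable_funX.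
rewrite ge0_integralZr//=; last 3 first.
- by apply/measurable_EFinP/measurable_funX.
- by move=> t _; rewrite lee_fin.
- by rewrite lee_fin ltW// double_rising_gt0.
by rewrite (chi_even_moment a (@s_law i)).
Qed.

(** With the radii frozen, the mean over the directions is [e_k] times the k-th power of alpha^2
    s_i^2 + beta^2 s_j^2; the binomial theorem then separates the two independent radii. *)
Lemma orf_even_moment i j alpha beta k : i != j ->
  (\int[P]_w ((alpha * (s i w * u i w) + beta * (s j w * u j w)) ^+ k.*2)%:E =
   (haar_even Q v i k * \sum_(l < k.+1) 'C(k, l)%:R *
     ((alpha ^+ 2) ^+ (k - l) * (beta ^+ 2) ^+ l) *
     (double_rising N (k - l) * double_rising N l))%:E)%E.
Proof.
move=> ij.
pose h (f : famType R ('I_n.+2 + 'I_n.+2 * 'I_n.+2)%type) : \bar R :=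
  ((alpha * (f (inl i) * \sum_l f (inr (i, l)) * v l) +
    beta * (f (inl j) * \sum_l f (inr (j, l)) * v l)) ^+ k.*2)%:E.
have mh : measurable_fun setT h.
  have mterm i' c : measurable_fun [set: famType R ('I_n.+2 + 'I_n.+2 * 'I_n.+2)%type]
      (fun f => c * (f (inl i') * \sum_l f (inr (i', l)) * v l)).
    apply: measurable_funM => //; apply: measurable_funM; first exact: measurable_fam_coord.
    apply: measurable_sum => l.
    by apply: measurable_funM => //; exact: measurable_fam_coord.
  by apply/measurable_EFinP/measurable_funX/measurable_funD.
have h0 f : (0 <= h f)%E by rewrite lee_fin.
have := splits_ge0_integral mX radius_direction_splits mh h0.
rewrite /h /mergefam/= => ->.
pose sq w := (alpha * s i w) ^+ 2 + (beta * s j w) ^+ 2.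
transitivity (\int[P]_w ((sq w ^+ k)%:E * (haar_even Q v i k)%:E))%E.
  apply: eq_integral => w _.
  have := @haar_proj_moment _ _ _ _ _ Q v i Q_haar (two_point i j (alpha * s i w) (beta * s j w)) k.
  rewrite (sum_two_point (F := fun x _ => x ^+ 2) _ _ ij); last by move=> _; rewrite expr0n.
  rewrite haar_evenE// => <-; apply: eq_integral => t _.
  rewrite (sum_two_point (F := fun x l => x * u l t) _ _ ij); last by move=> l; rewrite mul0r.
  by rewrite !mulrA.
have msq : measurable_fun setT sq.
  by apply: measurable_funD; apply: measurable_funX; exact: measurable_funM.
rewrite ge0_integralZr//=; last 3 first.
- by apply/measurable_EFinP/measurable_funX.
- by move=> w _; rewrite lee_fin exprn_ge0// addr_ge0 ?sqr_ge0.
- by rewrite -haar_evenE// integral_ge0// => w _; rewrite lee_fin.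
rewrite muleC EFinM; congr (_ * _)%E.
transitivity (\int[P]_w (\sum_(l < k.+1)
   ('C(k, l)%:R * ((alpha ^+ 2) ^+ (k - l) * (beta ^+ 2) ^+ l))%:E *
   (s i w ^+ (k - l).*2 * s j w ^+ l.*2)%:E))%E.
  apply: eq_integral => w _; rewrite /sq exprDn -sumEFin; apply: eq_bigr => l _.
  rewrite -EFinM (exprMn 2 alpha) (exprMn 2 beta) -!mul2n !exprM -mulr_natl.
  move: (alpha ^+ 2) (beta ^+ 2) (s i w ^+ 2) (s j w ^+ 2) => a b y z.
  by rewrite !exprMn; congr EFin; ring.
have coef_ge0 l : 0 <= 'C(k, l)%:R * ((alpha ^+ 2) ^+ (k - l) * (beta ^+ 2) ^+ l).
  by rewrite mulr_ge0// mulr_ge0// exprn_ge0// sqr_ge0.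
have mmon l : measurable_fun setT (fun w => (s i w ^+ (k - l).*2 * s j w ^+ l.*2)%:E).
  by apply/measurable_EFinP/measurable_funM; exact: measurable_funX.
rewrite ge0_integral_sum//=; last 2 first.
- by move=> l; apply: emeasurable_funM => //; exact: mmon.
- by move=> l w _; rewrite mule_ge0// lee_fin// mulr_ge0.
rewrite -sumEFin; apply: eq_bigr => l _.
rewrite ge0_integralZl_EFin//=.
- by rewrite chi_product_moment.
- by move=> w _; rewrite lee_fin mulr_ge0.
Qed.

Let measurable_orf i j alpha beta :
  measurable_fun setT (fun w => alpha * (s i w * u i w) + beta * (s j w * u j w)).
Proof.
have mu i' : measurable_fun setT (u i') by exact: measurable_haar_proj.
by apply: measurable_funD; apply: measurable_funM => //; exact: measurable_funM.
Qed.

(** With [beta = 0] only the term l = 0 survives, and its chi moment cancels the denominator of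
    [e_k]. The remaining moments are those of a centered normal variable of variance t^2 zz. *)
Lemma orf_cos_single i t :
  (\int[P]_w (cos (t * (s i w * u i w)))%:E = (expR (- (t ^+ 2 * zz) / 2))%:E)%E.
Proof.
have [j ji] := exists_other i.
transitivity (\int[P]_w (cos (t * (s i w * u i w) + 0 * (s j w * u j w)))%:E)%E.
  by apply: eq_integral => w _; rewrite mul0r addr0.
apply: (integral_cos_gauss_moments (measurable_orf i j t 0)).
move=> k; rewrite orf_even_moment// big_ord_recl/= big1 ?addr0; last first.
  by move=> l _; rewrite /bump/= add1n expr0n/= expr0n/= !(mulr0, mul0r).
rewrite bin0 subn0 expr0 double_rising0 mul1r !mulr1; congr EFin.
by rewrite mulrCA haar_even_prod// mulrA -exprMn.
Qed.

Definition orf_term (z2 : R) k :=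
  (- z2) ^+ k / (2 ^+ k * k`!%:R) * (Gamma (k%:R + N) / Gamma (k%:R + N / 2)).

(** Only the square of [eps] enters the moments, so sums and differences of two features are treated
    at once. *)
Lemma orf_cos_pair i j eps : i != j -> eps ^+ 2 = 1 ->
  (\int[P]_w (cos (s i w * u i w + eps * (s j w * u j w)))%:E =
   (Gamma (N / 2) / Gamma N * limn (series (orf_term zz)))%:E)%E.
Proof.
move=> ij eps2.
pose M k := zz ^+ k * double_rising 1 k / double_rising N k * double_rising (N + N) k.
have N0 : 0 < N by rewrite ltr0n.
have zz0 : 0 <= zz by apply: sumr_ge0 => *; exact: sqr_ge0.
have EM k : (\int[P]_w ((1 * (s i w * u i w) + eps * (s j w * u j w)) ^+ k.*2)%:E = (M k)%:E)%E.
  rewrite orf_even_moment// eps2 expr1n.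
  under eq_bigr do rewrite !expr1n !mulr1.
  rewrite double_rising_binomial; congr (_ * _)%:E.
  rewrite -(haar_even_prod v i Q_haar) mulfK// gt_eqF//; exact: double_rising_gt0.
have M_coef k : M k / k.*2`!%:R = zz ^+ k / (2 ^+ k * k`!%:R) * (double_rising (N + N) k / double_rising N k).
  rewrite fact_double /M.
  have := @double_rising_gt0 R 1 k ltr01; move: (double_rising 1 k) => p p0.
  have := @double_rising_gt0 R N k N0; move: (double_rising N k) => q q0.
  have f0 : 0 < k`!%:R :> R by rewrite ltr0n fact_gt0.
  have t0 : 0 < 2 ^+ k :> R by exact: exprn_gt0.
  move: (k`!%:R) f0 (2 ^+ k) t0 (zz ^+ k) (double_rising (N + N) k) => f f0 t t0 z r.
  by field; rewrite !gt_eqF.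
have ratio_ge0 k : 0 <= double_rising (N + N) k / double_rising N k.
  by rewrite divr_ge0 ?ltW ?double_rising_gt0 ?addr_gt0.
(* The ratio of rising factorials is at most 2^k, which the 2^k in (2k)! absorbs; what remains is
   the exponential series at zz. *)
have M_cvg : cvgn (series (fun k => M k / k.*2`!%:R)).
  apply: (series_le_cvg _ _ _ (is_cvg_series_exp_coeff zz)) => k.
  - by rewrite M_coef mulr_ge0// divr_ge0 ?exprn_ge0// mulr_ge0 ?exprn_ge0.
  - exact: exp_coeff_ge0.
  - rewrite M_coef /exp_coeff/= [leLHS](_ : _ = zz ^+ k / k`!%:R *
      (double_rising (N + N) k / double_rising N k / 2 ^+ k)).
      rewrite ler_piMr ?divr_ge0 ?exprn_ge0// ler_pdivrMr ?exprn_gt0// mul1r.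
      exact: double_rising_ratio_le.
    by rewrite [(_ * k`!%:R)^-1]invfM; ring.
transitivity (\int[P]_w (cos (1 * (s i w * u i w) + eps * (s j w * u j w)))%:E)%E.
  by apply: eq_integral => w _; rewrite mul1r.
rewrite (integral_cos_even_moments (measurable_orf i j 1 eps) EM M_cvg).
have Nhalf : 1 <= N / 2 by rewrite ler_pdivlMr// mul1r ler_nat.
have N1 : 1 <= N by rewrite ler1n.
have termE k : (-1) ^+ k * M k / k.*2`!%:R = Gamma (N / 2) / Gamma N * orf_term zz k.
  rewrite -mulrA M_coef /orf_term !Gamma_natD// !double_risingE.
  have -> : (N + N) / 2 = N by field.
  rewrite [in RHS]exprNn.
  have g1 := Gamma_gt0 N1; have g2 := Gamma_gt0 Nhalf.
  have q0 : 0 < \prod_(i0 < k) (N / 2 + i0%:R).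
    by apply: prodr_gt0 => l _; rewrite ltr_pwDl// divr_gt0.
  have f0 : 0 < k`!%:R :> R by rewrite ltr0n fact_gt0.
  have t0 : 0 < 2 ^+ k :> R by exact: exprn_gt0.
  move: (Gamma N) g1 (Gamma (N / 2)) g2 (\prod_(i0 < k) (N / 2 + _)) q0
    (k`!%:R) f0 (2 ^+ k) t0 (zz ^+ k) ((-1) ^+ k) (\prod_(_ < k) _).
  move=> g1 g10 g2 g20 q q0 f f0 t t0 z e r.
  by field; rewrite !gt_eqF.
rewrite (_ : (fun k => _) = (Gamma (N / 2) / Gamma N) *: orf_term zz); last first.
  by apply/funext => k; exact: termE.
rewrite lim_seriesZ//.
(* Moving the constant out of the limit requires convergence of the [orf_term] series. It converges
   absolutely, since its terms are up to sign and this positive constant those of the convergent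
   moment series. *)
have c0 : 0 < Gamma (N / 2) / Gamma N by rewrite divr_gt0 ?Gamma_gt0.
suff : cvgn (series (fun k => `|orf_term zz k|)) by move=> /normed_cvg.
rewrite (_ : (fun k => `|_|) = (Gamma (N / 2) / Gamma N)^-1 *: (fun k => M k / k.*2`!%:R)).
  exact: is_cvg_seriesZ.
apply/funext => k; apply: (mulfI (lt0r_neq0 c0)).
rewrite [RHS](mulVKf (lt0r_neq0 c0)) -{1}(gtr0_norm c0) -normrM -termE.
rewrite -mulrA normrM normrX normrN1 expr1n mul1r ger0_norm//.
by rewrite M_coef mulr_ge0// divr_ge0 ?exprn_ge0// mulr_ge0 ?exprn_ge0.
Qed.

End orf.

(** * Mean squared errors *)

Section mean_squared_error.
Context {R : realType} d (T : measurableType d) (P : probability T R).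

(** Integrability travels with the value, so that linearity composes without side conditions. *)
Definition has_mean (f : T -> R) (e : R) :=
  P.-integrable setT (EFin \o f) /\ (\int[P]_w (f w)%:E = e%:E)%E.

Lemma has_mean_cst c : has_mean (cst c) c.
Proof.
split; first exact: finite_measure_integrable_cst.
by have := integral_cst P measurableT c%:E; rewrite /= probability_setT mule1.
Qed.

Lemma has_meanD f g a b : has_mean f a -> has_mean g b ->
  has_mean (fun w => f w + g w) (a + b).
Proof.
move=> [If Ef] [Ig Eg]; split; first exact: (integrableD measurableT If Ig).
by rewrite EFinD -Ef -Eg -integralD//.
Qed.

Lemma has_meanZ c f a : has_mean f a -> has_mean (fun w => c * f w) (c * a).
Proof.
move=> [If Ef]; split; first exact: (integrableZl measurableT c If).
by rewrite EFinM -Ef -integralZl//.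
Qed.

Lemma has_mean_sum (I : finType) (f : I -> T -> R) (a : I -> R) :
  (forall i, has_mean (f i) (a i)) -> has_mean (fun w => \sum_i f i w) (\sum_i a i).
Proof.
move=> fa; elim: (index_enum I) => [|i r IHr].
  rewrite big_nil (_ : (fun w => _) = cst 0); first exact: has_mean_cst.
  by apply/funext => w; rewrite big_nil.
rewrite big_cons (_ : (fun w => _) = fun w => f i w + \sum_(j <- r) f j w).
  exact: has_meanD.
by apply/funext => w; rewrite big_cons.
Qed.

Lemma has_mean_cos (f : T -> R) e : measurable_fun setT f ->
  (\int[P]_w (cos (f w))%:E = e%:E)%E -> has_mean (fun w => cos (f w)) e.
Proof.
move=> mf fe; split => //.
have mcos : measurable_fun setT (fun w => cos (f w)).
  apply: measurableT_comp mf; apply: continuous_measurable_fun; exact: continuous_cos.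
apply: (@ae_bounded_integrable _ _ _ P _ 1) => //.
by apply: aeW => w; rewrite ler_norml cos_geN1 cos_le1.
Qed.

(** Products of cosines become sums of cosines. Each of the m+1 rows of the double sum has one
    diagonal term, of mean (1 + delta) / 2, and m others of mean [rho]; the cross term contributes -
    2 kappa^2. *)
Lemma integral_sqr_mean_cos (m : nat) (a : 'I_m.+1 -> T -> R) (kappa delta rho : R) :
  (forall i, measurable_fun setT (a i)) ->
  (forall i, \int[P]_w (cos (a i w))%:E = kappa%:E)%E ->
  (forall i, \int[P]_w (cos (2 * a i w))%:E = delta%:E)%E ->
  (forall i j, i != j -> \int[P]_w (cos (a i w + a j w))%:E = rho%:E)%E ->
  (forall i j, i != j -> \int[P]_w (cos (a i w - a j w))%:E = rho%:E)%E ->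
  (\int[P]_w ((m.+1%:R^-1 * (\sum_i cos (a i w)) - kappa) ^+ 2)%:E =
   (m.+1%:R^-1 * ((1 + delta) / 2 + m%:R * rho) - kappa ^+ 2)%:E)%E.
Proof.
move=> ma Ek Ed Ep Em; set M := m.+1%:R^-1.
have pair i j : has_mean (fun w => cos (a i w) * cos (a j w))
    (if i == j then (1 + delta) / 2 else rho).
  rewrite (_ : (fun w => _) = fun w => 2^-1 * (cos (a i w + a j w) + cos (a i w - a j w))); last first.
    by apply/funext => w; rewrite cosD cosB; field.
  case: eqVneq => [<-|ij].
    rewrite mulrC [1 + delta]addrC; apply/has_meanZ/has_meanD.
      rewrite (_ : (fun w => _) = fun w => cos (2 * a i w)).
        by apply: has_mean_cos; [exact: measurable_funM|exact: Ed].
      by apply/funext => w; congr cos; ring.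
    rewrite (_ : (fun w => _) = cst 1); first exact: has_mean_cst.
    by apply/funext => w; rewrite subrr cos0.
  rewrite (_ : rho = 2^-1 * (rho + rho)); last by field.
  apply/has_meanZ/has_meanD; apply: has_mean_cos.
  - exact: measurable_funD.
  - exact: Ep.
  - exact: measurable_funB.
  - exact: Em.
have single i : has_mean (fun w => cos (a i w)) kappa by exact: has_mean_cos.
have H := has_meanD (has_meanD
  (has_meanZ (M ^+ 2) (has_mean_sum (fun i => has_mean_sum (pair i))))
  (has_meanZ (- 2 * kappa * M) (has_mean_sum single))) (has_mean_cst (kappa ^+ 2)).
rewrite (eq_integral (fun w => (M ^+ 2 * (\sum_i \sum_j cos (a i w) * cos (a j w)) +
    - 2 * kappa * M * (\sum_i cos (a i w)) + kappa ^+ 2)%:E)); last first.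
  move=> w _; congr EFin.
  rewrite (_ : \sum_i \sum_j _ = (\sum_i cos (a i w)) ^+ 2); first by ring.
  by rewrite expr2 big_distrl/=; apply: eq_bigr => i _; rewrite big_distrr.
rewrite H.2; congr EFin.
have -> : \sum_(i < m.+1) \sum_(j < m.+1) (if i == j then (1 + delta) / 2 else rho) =
    m.+1%:R * ((1 + delta) / 2 + m%:R * rho) :> R.
  rewrite (eq_bigr (fun=> (1 + delta) / 2 + m%:R * rho)).
    by rewrite sumr_const card_ord -[LHS]mulr_natl.
  move=> i _; rewrite (bigD1 i)//= eqxx; congr (_ + _).
  rewrite (eq_bigr (fun=> rho)).
    by rewrite sumr_const cardC1 card_ord -[LHS]mulr_natl.
  by move=> j; rewrite eq_sym => /negbTE ->.
rewrite sumr_const card_ord -[kappa *+ _]mulr_natl.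
have M0 : m.+1%:R != 0 :> R by rewrite pnatr_eq0.
by rewrite /M; field; rewrite addrC natr1.
Qed.

End mean_squared_error.

(** * Independent Gaussian features *)

Section iid_features.
Context {R : realType} (m n : nat) d (T : measurableType d) (P : probability T R).
Variable G : 'I_m * 'I_n -> {RV P >-> R}.
Variable v : 'I_n -> R.
Hypothesis G_indep : mutually_independent P (fun ij => G ij : T -> R).
Hypothesis G_law : forall ij (B : set R), measurable B ->
  P (G ij @^-1` B) = normal_prob 0 1 B.

(** The entry (i, j) has coefficient c_i v_j, and the sum of the squares of these coefficients
    factors. *)
Lemma iid_feature_cos (c : 'I_m -> R) :
  (\int[P]_w (cos (\sum_i c i * \sum_j G (i, j) w * v j))%:E =
   (expR (- ((\sum_i c i ^+ 2) * \sum_j v j ^+ 2) / 2))%:E)%E.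
Proof.
have := iid_normal_cos G_indep G_law (fun e => c e.1 * v e.2).
rewrite (eq_bigr (fun e => (fun i j => c i ^+ 2 * v j ^+ 2) e.1 e.2)); last first.
  by move=> e _; rewrite exprMn.
rewrite -(pair_bigA _ (fun i j => c i ^+ 2 * v j ^+ 2))/= big_distrlr/= => <-.
apply: eq_integral => w _; congr (cos _)%:E.
rewrite [RHS](eq_bigr (fun e => (fun i j => c i * (G (i, j) w * v j)) e.1 e.2)); last first.
  by move=> [i j] _ /=; ring.
rewrite -(pair_bigA _ (fun i j => c i * (G (i, j) w * v j)))/=.
by apply: eq_bigr => i _; rewrite big_distrr.
Qed.

Lemma iid_feature_cos_pair i j a b : i != j ->
  (\int[P]_w (cos (a * (\sum_k G (i, k) w * v k) + b * (\sum_k G (j, k) w * v k)))%:E =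
   (expR (- ((a ^+ 2 + b ^+ 2) * \sum_j v j ^+ 2) / 2))%:E)%E.
Proof.
move=> ij; have := iid_feature_cos (two_point i j a b).
rewrite (sum_two_point (F := fun x _ => x ^+ 2) _ _ ij) => [<-|_]; last by rewrite expr0n.
apply: eq_integral => w _.
by rewrite (sum_two_point (F := fun x i => x * \sum_j G (i, j) w * v j) _ _ ij)// => l; rewrite mul0r.
Qed.

End iid_features.

Theorem theorem4p5 (R : realType) (d m : nat) (hd : (2 <= d)%N) (hm : (2 <= m)%N)
  (hmd : (m <= d)%N) (x y : 'rV[R]_d)
  (* IIDRF model: entries G (i, j) of w_1, ..., w_m i.i.d. N(0, 1) *)
  (d1 : measure_display) (T1 : measurableType d1) (P1 : probability T1 R)
  (G : 'I_m * 'I_d -> {RV P1 >-> R})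
  (hGind : mutually_independent P1 (fun ij => G ij : T1 -> R))
  (hGlaw : forall ij (B : set R), measurable B ->
      P1 (G ij @^-1` B) = normal_prob 0 1 B)
  (* ORF model: s_1..s_d i.i.d. chi_d, Q Haar on O(d), independent of s *)
  (d2 : measure_display) (T2 : measurableType d2) (P2 : probability T2 R)
  (s : 'I_d -> {RV P2 >-> R}) (Q : 'I_d * 'I_d -> {RV P2 >-> R})
  (hsind : mutually_independent P2 (fun i => s i : T2 -> R))
  (hslaw : forall i (B : set R), measurable B ->
      P2 (s i @^-1` B) = (\int[@lebesgue_measure R]_(r in B) (chi_pdf d r)%:E)%E)
  (hQ : haar_orthogonal P2 (fun w => \matrix_(j, k) Q (j, k) w))
  (hsQ : independent_vectors P2 (fun i => s i : T2 -> R) (fun jk => Q jk : T2 -> R)) :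
  let z := Num.sqrt (\sum_(j < d) (x 0 j - y 0 j) ^+ 2) in
  let W_iid := fun (w : T1) (i : 'I_m) => \row_(j < d) G (i, j) w in
  let W_orf := fun (w : T2) (i : 'I_m) =>
      \row_(j < d) (s (widen_ord hmd i) w * Q (widen_ord hmd i, j) w) in
  (rff_mse P1 W_iid x y - rff_mse P2 W_orf x y)%E =
  ((m.-1)%:R / m%:R *
    (expR (- z ^+ 2) - Gamma (d%:R / 2) / Gamma d%:R *
      limn (fun n : nat => \sum_(0 <= k < n) ((- z ^+ 2) ^+ k / (2 ^+ k * k`!%:R) *
                          (Gamma (k%:R + d%:R) / Gamma (k%:R + d%:R / 2))))))%:E.
Proof.
case: d hd hmd x y G hGind hGlaw s Q hsind hslaw hQ hsQ => [|[|n]] hd //.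
case: m hm => [|[|m']] hm //.
move=> hmd' x' y' G' hGi hGl s' Q' hsi hsl hQ' hsQ' z W_iid W_orf.
pose v j := x' 0 j - y' 0 j.
pose zz := \sum_j v j ^+ 2.
have z2 : z ^+ 2 = zz by rewrite sqr_sqrtr// sumr_ge0// => j _; exact: sqr_ge0.
pose kappa := expR (- zz / 2).
have mse1 : rff_mse P1 W_iid x' y' = (m'.+2%:R^-1 * ((1 + expR (- (2 ^+ 2 * zz) / 2)) / 2 +
    m'.+1%:R * expR (- zz)) - kappa ^+ 2)%:E.
  pose a i w := \sum_j G' (i, j) w * v j.
  have pair := iid_feature_cos_pair v hGi hGl.
  have single i t : (\int[P1]_w (cos (t * a i w))%:E = (expR (- (t ^+ 2 * zz) / 2))%:E)%E.
    have [j ij] := exists_other i.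
    have := pair i j t 0 ij; rewrite expr0n addr0 => <-.
    by apply: eq_integral => w _; rewrite mul0r addr0.
  rewrite -(@integral_sqr_mean_cos _ _ _ P1 _ a kappa _ (expR (- zz))).
  - rewrite /rff_mse; apply: eq_integral => w _; rewrite /rff_estimator.
    congr ((_ * _ - _) ^+ 2)%:E; apply: eq_bigr => i _; congr cos.
    by apply: eq_bigr => j _; rewrite mxE.
  - by move=> i; apply: measurable_sum => j; exact: measurable_funM.
  - move=> i; have := single i 1; rewrite expr1n mul1r => <-.
    by apply: eq_integral => w _; rewrite mul1r.
  - by move=> i; exact: single.
  (* The sum of two independent projections is normal of variance 2 zz, whence exp (- zz). *)
  - move=> i j ij; rewrite (_ : - zz = - ((1 ^+ 2 + 1 ^+ 2) * zz) / 2); last by field.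
    by rewrite -(pair i j)//; apply: eq_integral => w _; rewrite !mul1r.
  - move=> i j ij; rewrite (_ : - zz = - ((1 ^+ 2 + (-1) ^+ 2) * zz) / 2); last by field.
    by rewrite -(pair i j)//; apply: eq_integral => w _; rewrite !mul1r mulN1r.
have mse2 : rff_mse P2 W_orf x' y' = (m'.+2%:R^-1 * ((1 + expR (- (2 ^+ 2 * zz) / 2)) / 2 + m'.+1%:R *
    (Gamma (n.+2%:R / 2) / Gamma n.+2%:R * limn (series (orf_term n zz)))) - kappa ^+ 2)%:E.
  pose a i w := s' (widen_ord hmd' i) w * haar_proj Q' v (widen_ord hmd' i) w.
  have single i t := orf_cos_single v hsi hsl hQ' hsQ' (widen_ord hmd' i) t.
  (* [ij] also proves that the widened indices differ, because ordinals are compared by value and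
     [widen_ord] keeps the value. *)
  have pair i j eps (ij : i != j) := @orf_cos_pair _ _ _ _ _ _ _ v hsi hsl hQ' hsQ'
    (widen_ord hmd' i) (widen_ord hmd' j) eps ij.
  rewrite -(@integral_sqr_mean_cos _ _ _ P2 _ a kappa).
  - rewrite /rff_mse; apply: eq_integral => w _; rewrite /rff_estimator.
    congr ((_ * _ - _) ^+ 2)%:E; apply: eq_bigr => i _; congr cos.
    by rewrite /a big_distrr/=; apply: eq_bigr => j _; rewrite mxE mulrA.
  - by move=> i; apply: measurable_funM => //; exact: measurable_haar_proj.
  - move=> i; have := single i 1; rewrite expr1n mul1r => <-.
    by apply: eq_integral => w _; rewrite mul1r.
  - by move=> i; exact: single.
  - move=> i j ij; rewrite -(pair i j 1 ij (expr1n _ _)).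
    by apply: eq_integral => w _; rewrite mul1r.
  - move=> i j ij; rewrite -(pair i j (-1) ij) ?sqrrN ?expr1n//.
    by apply: eq_integral => w _; rewrite mulN1r.
rewrite mse1 mse2 -EFinB; congr EFin; rewrite z2.
rewrite [limn (fun k => _)](_ : _ = limn (series (orf_term n zz)))//.
rewrite -[m'.+2.-1]/(m'.+1).
set c := Gamma (n.+2%:R / 2) / Gamma n.+2%:R * limn (series (orf_term n zz)).
(* Both errors share the diagonal term and [kappa ^+ 2], so only the off-diagonal means [e1] and [c]
   remain, with weight [m1 * M]. *)
move: c (expR (- zz)) (expR (- (2 ^+ 2 * zz) / 2)) (kappa ^+ 2) (m'.+2%:R^-1) (m'.+1%:R).
by move=> c e1 e2 k2 M m1; ring.
Qed.
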